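(* Let $n>5$. (i) If $n$ is odd and $R$ is an $(n+2)$-dimensional solvable complex Leibniz algebra with nilradical isomorphic to $g^1_{(n,1)}$, then $R$ is isomorphic to the Lie algebra $R(g^1_{(n,1)},2)$ with basis $\{e_1,\dots,e_n,x,y\}$, in which $e_1,\dots,e_n$ have the brackets of $g^1_{(n,1)}$ and the remaining nonzero brackets are $[e_1,x]=-[x,e_1]=e_1$; $[e_i,x]=-[x,e_i]=(i-2)e_i$ for $2\le i\le n-1$; $[e_n,x]=-[x,e_n]=(n-4)e_n$; $[e_i,y]=-[y,e_i]=e_i$ for $2\le i\le n-1$; $[e_n,y]=-[y,e_n]=2e_n$. (ii) If $R$ is an $(n+2)$-dimensional solvable complex Leibniz algebra with nilradical isomorphic to $g^2_{(n,1)}$, then $R$ is isomorphic to the Lie algebra $R(g^2_{(n,1)},2)$ with basis $\{e_1,\dots,e_n,x,y\}$, in which $e_1,\dots,e_n$ have the brackets of $g^2_{(n,1)}$ and the remaining nonzero brackets are $[e_1,x]=-[x,e_1]=e_1$; $[e_i,x]=-[x,e_i]=(i-2)e_i$ for $2\le i\le n-1$; $[e_n,x]=-[x,e_n]=2e_n$; $[e_i,y]=-[y,e_i]=e_i$ for $2\le i\le n-1$. (In both algebras all brackets among $x,y$ and all brackets of basis elements not listed are zero.)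
   Context: A Leibniz algebra is a complex vector space with a bilinear bracket satisfying $[u,[v,w]]=[[u,v],w]-[[u,w],v]$; solvable, nilpotent and the nilradical (maximal nilpotent ideal) are defined as usual via derived and lower central series. $g^1_{(n,1)}$ ($n$ odd): Lie algebra with basis $e_1,\dots,e_n$ and nonzero brackets $[e_1,e_i]=-[e_i,e_1]=e_{i+1}$ ($2\le i\le n-2$), $[e_i,e_{n-i}]=-[e_{n-i},e_i]=(-1)^ie_n$ ($2\le i\le\frac{n-1}{2}$). $g^2_{(n,1)}$: Lie algebra with basis $e_1,\dots,e_n$ and nonzero brackets $[e_1,e_i]=-[e_i,e_1]=e_{i+1}$ ($2\le i\le n-2$), $[e_i,e_n]=-[e_n,e_i]=e_{i+2}$ ($2\le i\le n-3$). *)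

(* Defs.v *)
(* Complex numbers are modelled as R[i] = complex R for an
   arbitrary R : realType (every realType is the real line). *)
From HB Require Import structures.
From mathcomp Require Import all_boot all_order all_algebra.
From mathcomp Require Import reals.
From mathcomp.real_closed Require Import complex.
Set Implicit Arguments. Unset Strict Implicit. Unset Printing Implicit Defensive.
Import Order.TTheory GRing.Theory Num.Theory.
Local Open Scope ring_scope.

Section Leibniz.
Variable F : fieldType.
Variable d : nat.
Notation V := 'rV[F]_d.
Variable br : V -> V -> V.

Definition leibniz_algebra : Prop :=
  [/\ (forall (a : F) u v w, br (a *: u + v) w = a *: br u w + br v w),
      (forall (a : F) u v w, br w (a *: u + v) = a *: br w u + br w v) &
      (forall u v w, br u (br v w) = br (br u v) w - br (br u w) v)].

(* [A,B] : the subspace spanned by all brackets [a,b], a in A, b in B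
   (by bilinearity, spanned by brackets of basis vectors). *)
Definition brsp (A B : {vspace V}) : {vspace V} :=
  (\sum_(i < \dim A) \sum_(j < \dim B)
     <[br (tnth (vbasis A) i) (tnth (vbasis B) j)]>)%VS.

Definition is_ideal (I : {vspace V}) : Prop :=
  (brsp fullv I <= I)%VS /\ (brsp I fullv <= I)%VS.

Definition lcs (I : {vspace V}) (k : nat) : {vspace V} :=
  iter k (fun J => brsp J I) I.

Definition nilpotent_sub (I : {vspace V}) : Prop := exists k, lcs I k = 0%VS.

Definition derived (k : nat) : {vspace V} := iter k (fun J => brsp J J) fullv.

Definition solvable_alg : Prop := exists k, derived k = 0%VS.

Definition is_nilradical (N : {vspace V}) : Prop :=
  [/\ is_ideal N, nilpotent_sub N &
      forall J : {vspace V}, is_ideal J -> nilpotent_sub J -> (N <= J)%VS -> J = N].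
End Leibniz.

Definition alg_iso (F : fieldType) (d : nat) (br1 br2 : 'rV[F]_d -> 'rV[F]_d -> 'rV[F]_d) : Prop :=
  exists M : 'M[F]_d, M \in unitmx /\
    forall u v, br1 u v *m M = br2 (u *m M) (v *m M).

Definition sub_iso (F : fieldType) (m d : nat) (brm : 'rV[F]_m -> 'rV[F]_m -> 'rV[F]_m)
    (br : 'rV[F]_d -> 'rV[F]_d -> 'rV[F]_d) (N : {vspace 'rV[F]_d}) : Prop :=
  exists M : 'M[F]_(m, d),
    [/\ row_free M, (forall u, u *m M \in N), \dim N = m &
        forall u v, brm u v *m M = br (u *m M) (v *m M)].

(* algebras given by structure constants: basis e_1..e_m (1-based, e_k is the
   k-th standard row vector), c a b = [e_a, e_b] *)
Definition ee (F : fieldType) (m k : nat) : 'rV[F]_m := \row_(j < m) ((j.+1 == k)%:R).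

Definition sc_bracket (F : fieldType) (m : nat) (c : nat -> nat -> 'rV[F]_m)
    (u v : 'rV[F]_m) : 'rV[F]_m :=
  \sum_(i < m) \sum_(j < m) (u 0 i * v 0 j) *: c i.+1 j.+1.

Definition g1c (F : fieldType) (m n a b : nat) : 'rV[F]_m :=
  if (a == 1%N) && (2 <= b <= n - 2)%N then ee F m b.+1
  else if (b == 1%N) && (2 <= a <= n - 2)%N then - ee F m a.+1
  else if (2 <= a <= (n - 1)./2)%N && (b == n - a)%N then (-1) ^+ a *: ee F m n
  else if (2 <= b <= (n - 1)./2)%N && (a == n - b)%N then - ((-1) ^+ b *: ee F m n)
  else 0.

Definition g2c (F : fieldType) (m n a b : nat) : 'rV[F]_m :=
  if (a == 1%N) && (2 <= b <= n - 2)%N then ee F m b.+1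
  else if (b == 1%N) && (2 <= a <= n - 2)%N then - ee F m a.+1
  else if (2 <= a <= n - 3)%N && (b == n) then ee F m a.+2
  else if (a == n) && (2 <= b <= n - 3)%N then - ee F m b.+2
  else 0.

(* extension by x = e_{n+1}, y = e_{n+2} with [e_a, x] = wx a e_a = -[x, e_a],
   [e_a, y] = wy a e_a = -[y, e_a], all brackets among x, y zero *)
Definition extc (F : fieldType) (n : nat) (base : nat -> nat -> 'rV[F]_(n + 2))
    (wx wy : nat -> F) (a b : nat) : 'rV[F]_(n + 2) :=
  if (a <= n)%N && (b <= n)%N then base a b
  else if (b == n.+1) && (1 <= a <= n)%N then wx a *: ee F (n + 2) a
  else if (a == n.+1) && (1 <= b <= n)%N then - (wx b *: ee F (n + 2) b)
  else if (b == n.+2) && (1 <= a <= n)%N then wy a *: ee F (n + 2) a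
  else if (a == n.+2) && (1 <= b <= n)%N then - (wy b *: ee F (n + 2) b)
  else 0.

Definition wx1 (F : fieldType) (n a : nat) : F :=
  if a == 1%N then 1 else if (a <= n - 1)%N then (a - 2)%:R else (n - 4)%:R.
Definition wy1 (F : fieldType) (n a : nat) : F :=
  if a == 1%N then 0 else if (a <= n - 1)%N then 1 else 2.
Definition wx2 (F : fieldType) (n a : nat) : F :=
  if a == 1%N then 1 else if (a <= n - 1)%N then (a - 2)%:R else 2.
Definition wy2 (F : fieldType) (n a : nat) : F :=
  if a == 1%N then 0 else if (a <= n - 1)%N then 1 else 0.

Definition g1_br (F : fieldType) (n : nat) := sc_bracket (g1c F n n).
Definition g2_br (F : fieldType) (n : nat) := sc_bracket (g2c F n n).
Definition R1_br (F : fieldType) (n : nat) :=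
  sc_bracket (extc (g1c F (n + 2) n) (wx1 F n) (wy1 F n)).
Definition R2_br (F : fieldType) (n : nat) :=
  sc_bracket (extc (g2c F (n + 2) n) (wx2 F n) (wy2 F n)).
Arguments g1_br : clear implicits.
Arguments g2_br : clear implicits.
Arguments R1_br : clear implicits.
Arguments R2_br : clear implicits.

(* Main.v *)
Require Import Defs.
From HB Require Import structures.
From mathcomp Require Import all_boot all_order all_algebra.
From mathcomp Require Import zify ring.
From mathcomp Require Import reals.
From mathcomp.real_closed Require Import complex.
Set Implicit Arguments. Unset Strict Implicit. Unset Printing Implicit Defensive.
Import Order.TTheory GRing.Theory Num.Theory.
Local Open Scope ring_scope.

(* Order the basis of the nilradical N as b_0, b_1, ... so that every right
   multiplication is triangular on N, with diagonal entries p_j al + q_j be for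
   a pair (al, be) depending linearly on the acting element.  The pair vanishes
   on N and on [R,R].  An ideal J containing N, with [J,J] inside N and on which
   the pair vanishes, is nilpotent, hence equal to N.  Applied to N + (derived
   term), this gives [R,R] <= N without Lie's theorem; applied to N + <u>, it
   shows that the pair is injective on R/N, so it maps R onto the plane.

   Choose z with pair (1, n): its eigenvalues on N are then distinct and
   nonzero.  So R is the direct sum of N and T = {u | [u,z] = 0}, and N is a sum
   of eigenlines.  R_z is a derivation, so [T,T] lies in N with eigenvalue 0 and
   vanishes, T acts diagonally on the eigenlines, and a bracket of eigenvectors
   is zero unless the sum of their weights is a weight.  Left multiplication by T
   is the opposite of right multiplication, as [v,w] + [w,v] is annihilated from
   the left while most eigenvectors are not, and the others are brackets. *)

(** * Linear predicates and induction on spans *)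

(** A [Prop]-valued predicate rather than a subspace, so that span induction also serves
    antisymmetry, membership in a row space and [diag_wt _ 0 0]. *)
Definition lin_closed (F : fieldType) (V : vectType F) (P : V -> Prop) : Prop :=
  P 0 /\ forall a u v, P u -> P v -> P (a *: u + v).

Section LinClosed.
Variables (F : fieldType) (V : vectType F).
Implicit Type P : V -> Prop.

Lemma lin_closed_sum P (I : Type) (r : seq I) (c : I -> F) (f : I -> V) :
  lin_closed P -> (forall i, P (f i)) -> P (\sum_(i <- r) c i *: f i).
Proof.
move=> [P0 Pl] Pf; elim: r => [|i r IHr]; first by rewrite big_nil.
by rewrite big_cons; apply: Pl.
Qed.

Lemma lin_closed_span P (X : seq V) :
  lin_closed P -> (forall x, x \in X -> P x) -> forall v, v \in <<X>>%VS -> P v.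
Proof.
move=> cP PX v /(@coord_span _ _ _ (in_tuple X)) ->.
by apply: lin_closed_sum => // i; apply: PX; apply: mem_nth.
Qed.

Lemma lin_closed_span_map P (I : eqType) (f : I -> V) (r : seq I) :
  lin_closed P -> (forall i, i \in r -> P (f i)) ->
  forall v, v \in <<[seq f i | i <- r]>>%VS -> P v.
Proof. by move=> cP H; apply: lin_closed_span => // x /mapP[i ir ->]; apply: H. Qed.

Lemma lin_closed_mem (W : {vspace V}) : lin_closed (fun v => v \in W).
Proof. by split=> [|a u v uW vW]; rewrite ?mem0v // rpredD ?rpredZ. Qed.

End LinClosed.

(** * Leibniz brackets, products of subspaces, ideals *)

Section Bracket.
Variables (F : fieldType) (d : nat).
Notation V := 'rV[F]_d.
Variable br : V -> V -> V.
Hypothesis Lbr : leibniz_algebra br.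
Implicit Types (a : F) (u v w : V) (A B C J X Y W : {vspace V}).

Lemma brDl u v w : br (u + v) w = br u w + br v w.
Proof. by case: Lbr => H _ _; have := H 1 u v w; rewrite !scale1r. Qed.

Lemma brDr u v w : br w (u + v) = br w u + br w v.
Proof. by case: Lbr => _ H _; have := H 1 u v w; rewrite !scale1r. Qed.

Lemma br0l w : br 0 w = 0.
Proof. by apply: (addrI (br 0 w)); rewrite -brDl !addr0. Qed.

Lemma br0r w : br w 0 = 0.
Proof. by apply: (addrI (br w 0)); rewrite -brDr !addr0. Qed.

Lemma brZl a u w : br (a *: u) w = a *: br u w.
Proof. by case: Lbr => H _ _; have := H a u 0 w; rewrite br0l !addr0. Qed.

Lemma brZr a u w : br w (a *: u) = a *: br w u.
Proof. by case: Lbr => _ H _; have := H a u 0 w; rewrite br0r !addr0. Qed.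

Lemma brNl u w : br (- u) w = - br u w.
Proof. by rewrite -scaleN1r brZl scaleN1r. Qed.

Lemma brNr u w : br w (- u) = - br w u.
Proof. by rewrite -scaleN1r brZr scaleN1r. Qed.

Lemma brBl u v w : br (u - v) w = br u w - br v w.
Proof. by rewrite brDl brNl. Qed.

Lemma br_suml (I : Type) (r : seq I) (c : I -> F) (f : I -> V) w :
  br (\sum_(i <- r) c i *: f i) w = \sum_(i <- r) c i *: br (f i) w.
Proof.
elim: r => [|i r IHr]; first by rewrite !big_nil br0l.
by rewrite !big_cons brDl brZl IHr.
Qed.

Lemma br_sumr (I : Type) (r : seq I) (c : I -> F) (f : I -> V) w :
  br w (\sum_(i <- r) c i *: f i) = \sum_(i <- r) c i *: br w (f i).
Proof.
elim: r => [|i r IHr]; first by rewrite !big_nil br0r.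
by rewrite !big_cons brDr brZr IHr.
Qed.

Lemma br_br u v w : br u (br v w) = br (br u v) w - br (br u w) v.
Proof. by case: Lbr. Qed.

(** Right multiplications are derivations; most uses of the Leibniz identity below take this
    form. *)
Lemma br_derivation u v w : br (br u v) w = br u (br v w) + br (br u w) v.
Proof. by rewrite br_br addrNK. Qed.

(** The Leibniz expansions of the two terms cancel. This is the substitute for antisymmetry in a
    Leibniz algebra: symmetrised brackets lie in the right annihilator. *)
Lemma br_sym_annr u v w : br u (br v w + br w v) = 0.
Proof. by rewrite brDr !br_br addrA subrK subrr. Qed.

Lemma lin_closed_brl (P : V -> Prop) w : lin_closed P -> lin_closed (fun v => P (br v w)).
Proof.
move=> [P0 Pl]; split; first by rewrite br0l.
by move=> a u v Pu Pv; rewrite brDl brZl; apply: Pl.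
Qed.

Lemma lin_closed_brr (P : V -> Prop) w : lin_closed P -> lin_closed (fun v => P (br w v)).
Proof.
move=> [P0 Pl]; split; first by rewrite br0r.
by move=> a u v Pu Pv; rewrite brDr brZr; apply: Pl.
Qed.

Lemma br_span (X Y : seq V) W :
  (forall x y, x \in X -> y \in Y -> br x y \in W) ->
  forall u v, u \in <<X>>%VS -> v \in <<Y>>%VS -> br u v \in W.
Proof.
move=> H u v uX vY; move: u uX.
apply: lin_closed_span; first exact: lin_closed_brl (lin_closed_mem _).
move=> x xX; move: v vY.
apply: lin_closed_span; first exact: lin_closed_brr (lin_closed_mem _).
by move=> y; apply: H.
Qed.

Lemma brsp_ind (P : V -> Prop) A B : lin_closed P ->
  (forall u v, u \in A -> v \in B -> P (br u v)) ->
  forall w, w \in brsp br A B -> P w.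
Proof.
move=> cP H w /memv_sumP[f Hf ->].
(* [lin_closed_sum] handles linear combinations, so plain sums are given coefficients 1. *)
have E i : 1 *: f i = f i by rewrite scale1r.
under eq_bigr do rewrite -E.
apply: lin_closed_sum => // i; have /memv_sumP[g Hg ->] := Hf i isT.
have E' j : 1 *: g j = g j by rewrite scale1r.
under eq_bigr do rewrite -E'.
apply: lin_closed_sum => // j; have /vlineP[c ->] := Hg j isT.
case: (cP) => P0 Pl; rewrite -[_ *: _]addr0; apply: Pl => //.
by apply: H; apply: vbasis_mem; apply: mem_tnth.
Qed.

Lemma brsp_sub A B W :
  (forall u v, u \in A -> v \in B -> br u v \in W) -> (brsp br A B <= W)%VS.
Proof. by move=> H; apply/subvP; apply: brsp_ind => //; apply: lin_closed_mem. Qed.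

Lemma brsp_mem A B u v : u \in A -> v \in B -> br u v \in brsp br A B.
Proof.
have spanE (C : {vspace V}) : C = <<vbasis C>>%VS by rewrite (span_basis (vbasisP C)).
rewrite {1}(spanE A) {1}(spanE B); apply: br_span => x y.
move=> /tnthP[i ->] /tnthP[j ->].
apply: (subvP _ _ (memv_line _)).
by apply: (sumv_sup i) => //; apply: (sumv_sup j).
Qed.

Lemma is_idealP J :
  is_ideal br J <-> forall u v, u \in J -> br u v \in J /\ br v u \in J.
Proof.
split=> [[/subvP J1 /subvP J2] u v uJ|H].
  by split; [apply: J2 | apply: J1]; apply: brsp_mem => //; rewrite memvf.
by split; apply: brsp_sub => u v uJ vJ; [case: (H v u) | case: (H u v)].
Qed.

(** The Leibniz identity, in either form, carries the outer factor into one of the two inner ones,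
    where the ideal property of [J] absorbs it. *)
Lemma ideal_brsp J : is_ideal br J -> is_ideal br (brsp br J J).
Proof.
move=> /is_idealP HJ; apply/is_idealP => w v wJ; split; move: w wJ.
- apply: brsp_ind; first exact: lin_closed_brl (lin_closed_mem _).
  move=> a b aJ bJ; rewrite br_derivation rpredD // brsp_mem //.
    by case: (HJ _ v bJ).
  by case: (HJ _ v aJ).
- apply: brsp_ind; first exact: lin_closed_brr (lin_closed_mem _).
  move=> a b aJ bJ; rewrite br_br rpredB // brsp_mem //.
    by case: (HJ _ v aJ).
  by case: (HJ _ v bJ).
Qed.

Lemma ideal_derived k : is_ideal br (derived br k).
Proof.
elim: k => [|k IHk]; last exact: ideal_brsp.
by apply/is_idealP => u v _; rewrite !memvf.
Qed.

End Bracket.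

(** * The decreasing flag of an ordered basis *)

Section Flag.
Variables (F : numFieldType) (d : nat).
Notation V := 'rV[F]_d.
Variables (n : nat) (b : nat -> V).

(** Spans of the tails of the ordered basis: [flag 0] is the whole span and [flag n] is 0, so
    triangularity becomes stability of every [flag k]. *)
Definition flag k : {vspace V} := <<[seq b j | j <- iota k (n - k)]>>%VS.

Lemma flag_mem j k : (k <= j < n)%N -> b j \in flag k.
Proof. by move=> /andP[kj jn]; apply/memv_span/map_f; rewrite mem_iota; lia. Qed.

Lemma flag_ind k (P : V -> Prop) : lin_closed P ->
  (forall j, (k <= j < n)%N -> P (b j)) -> forall v, v \in flag k -> P v.
Proof.
move=> cP H; apply: lin_closed_span_map => // i; rewrite mem_iota => iI.
by apply: H; lia.
Qed.

Lemma flagW j k v : (k <= j)%N -> v \in flag j -> v \in flag k.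
Proof.
move=> kj; move: v; apply: flag_ind; first exact: lin_closed_mem.
by move=> i iI; apply: flag_mem; lia.
Qed.

Lemma flag_end k v : (n <= k)%N -> v \in flag k -> v = 0.
Proof.
rewrite -subn_eq0 => /eqP nk; rewrite /flag nk /= span_nil memv0.
by move/eqP.
Qed.

Lemma flag_cons k : (k < n)%N -> flag k = (<[b k]> + flag k.+1)%VS.
Proof. by move=> kn; rewrite /flag -(subnSK kn) /= span_cons. Qed.

Lemma flag_dec k v : (k < n)%N -> v \in flag k -> exists a, v - a *: b k \in flag k.+1.
Proof.
move=> kn; rewrite flag_cons // => /memv_addP[x /vlineP[a ->] [w wU ->]].
by exists a; rewrite addrAC subrr add0r.
Qed.

Hypothesis free_b : free [seq b j | j <- iota 0 n].

Lemma flag_free a k : (k < n)%N -> a *: b k \in flag k.+1 -> a = 0.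
Proof.
move=> kn; have [//|a0] := eqVneq a 0; rewrite rpredZeq (negPf a0) /=.
have : free [seq b j | j <- iota k (n - k)].
  elim: k {kn} => [|k IHk]; first by rewrite subn0.
  case: (ltnP k n) => kn; last by rewrite (_ : (n - k.+1 = 0)%N) ?nil_free //; lia.
  by move: IHk; rewrite -subnSK //= free_cons => /andP[].
by rewrite -subnSK //= free_cons => /andP[/negPf bk _]; rewrite /flag bk.
Qed.

Lemma flag_coef a a' k v : (k < n)%N ->
  v - a *: b k \in flag k.+1 -> v - a' *: b k \in flag k.+1 -> a = a'.
Proof.
move=> kn h h'; apply/eqP; rewrite -subr_eq0; apply/eqP.
apply: (flag_free kn); have := rpredB h' h.
by rewrite opprB addrC addrA subrK scalerBl.
Qed.

End Flag.

(** * Diagonal weights and the nilradical *)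

Section Weights.
Variables (F : numFieldType) (d : nat).
Notation V := 'rV[F]_d.
Variables (br : V -> V -> V) (n : nat) (b : nat -> V) (p q : nat -> nat).
Hypothesis Lbr : leibniz_algebra br.
Notation U := (flag n b).
Implicit Types (u v w : V) (al be : F).

(** In both applications [p j] and [q j] are the eigenvalues of the future [x] and [y] on the [j]-th
    vector of the ordered basis. *)
Definition wt al be j : F := al * (p j)%:R + be * (q j)%:R.

Definition diag_wt u al be : Prop :=
  forall j, (j < n)%N -> br (b j) u - wt al be j *: b j \in U j.+1.

Lemma wt00 j : wt 0 0 j = 0.
Proof. by rewrite /wt !mul0r addr0. Qed.

Lemma diag_wt_nilP u :
  diag_wt u 0 0 <-> forall j, (j < n)%N -> br (b j) u \in U j.+1.
Proof. by split=> H j jn; have := H j jn; rewrite wt00 scale0r subr0. Qed.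

Lemma diag_wt_stable u al be : diag_wt u al be ->
  forall k v, v \in U k -> br v u \in U k.
Proof.
move=> Hu k; apply: flag_ind; first exact: lin_closed_brl (lin_closed_mem _).
move=> j /andP[kj jn]; rewrite -(subrK (wt al be j *: b j) (br _ _)).
rewrite rpredD ?rpredZ ?flag_mem ?kj //.
by apply: flagW (Hu j jn); lia.
Qed.

Lemma diag_wt_nil u : diag_wt u 0 0 ->
  forall k v, v \in U k -> br v u \in U k.+1.
Proof.
move=> /diag_wt_nilP Hu k; apply: flag_ind; first exact: lin_closed_brl (lin_closed_mem _).
by move=> j /andP[kj jn]; apply: flagW (Hu j jn); lia.
Qed.

Lemma diag_wt_lin c u v al be al' be' : diag_wt u al be -> diag_wt v al' be' ->
  diag_wt (c *: u + v) (c * al + al') (c * be + be').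
Proof.
move=> Hu Hv j jn; rewrite (brDr Lbr) (brZr Lbr).
have -> : wt (c * al + al') (c * be + be') j = c * wt al be j + wt al' be' j.
  by rewrite /wt; ring.
rewrite scalerDl opprD addrACA -scalerA -scalerBr.
by rewrite rpredD ?rpredZ ?Hu ?Hv.
Qed.

(** With R_u for right multiplication by [u], R_[u,v] = R_v R_u - R_u R_v. The diagonal parts
    commute, so only a strictly triangular part remains. *)
Lemma diag_wt_br u v al be al' be' : diag_wt u al be -> diag_wt v al' be' ->
  diag_wt (br u v) 0 0.
Proof.
move=> Hu Hv; apply/diag_wt_nilP => j jn; rewrite (br_br Lbr).
have [t tU Et] : exists2 t, t \in U j.+1 & br (b j) u = wt al be j *: b j + t.
  by exists (br (b j) u - wt al be j *: b j); [exact: Hu | rewrite addrC subrK].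
have [s sU Es] : exists2 s, s \in U j.+1 & br (b j) v = wt al' be' j *: b j + s.
  by exists (br (b j) v - wt al' be' j *: b j); [exact: Hv | rewrite addrC subrK].
rewrite Et Es !(brDl Lbr) !(brZl Lbr) Et Es !scalerDr !scalerA.
rewrite [wt al' be' j * _]mulrC.
set y := _ *: b j; rewrite -[in X in X - _](addrA y) -[in X in _ - X](addrA y).
rewrite opprD addrACA subrr add0r.
have := diag_wt_stable Hv tU; have := diag_wt_stable Hu sU => h1 h2.
by rewrite rpredD ?rpredN ?rpredD ?rpredZ.
Qed.

Section Nilradical.
Hypothesis nilrad : is_nilradical br (U 0).
Hypothesis diag_wt_ex : forall u, exists al be, diag_wt u al be.
Hypothesis diag_wt_N : forall u, u \in U 0 -> diag_wt u 0 0.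

(** The lower central series of [J] sinks through the flag: the first bracket falls into [U 0], and
    each further right multiplication by [J] descends one step. So [J] is nilpotent, and maximality
    of the nilradical applies. *)
Lemma nilradical_max (J : {vspace V}) : is_ideal br J -> (U 0 <= J)%VS ->
  (forall u v, u \in J -> v \in J -> br u v \in U 0) ->
  (forall u, u \in J -> diag_wt u 0 0) -> J = U 0.
Proof.
move=> idJ NJ JJ J0; case: nilrad => _ _; apply=> //.
have H k : (lcs br J k.+1 <= U k)%VS.
  elim: k => [|k /subvP IHk]; first exact: brsp_sub.
  by apply: brsp_sub => // u v /IHk uU vJ; apply: diag_wt_nil => //; apply: J0.
by exists n.+1; apply/eqP; rewrite -subv0; have := H n; rewrite [flag _ _ n]/flag subnn span_nil.
Qed.

Hypothesis solv : solvable_alg br.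

Let idN u v : u \in U 0 -> br u v \in U 0 /\ br v u \in U 0.
Proof. by case: nilrad => /is_idealP-/(_ Lbr) H _ _; apply: H. Qed.

(** Descending induction on the derived series, starting at a term that solvability makes zero. If
    [derived br k.+2] lies in N, then N + [derived br k.+1] satisfies the conditions of
    [nilradical_max], since the pair vanishes on brackets. *)
Lemma derived_sub_nilradical u v : br u v \in U 0.
Proof.
have D0 k w : w \in derived br k.+1 -> diag_wt w 0 0.
  move: w; apply: brsp_ind; last first.
    move=> a c _ _; have [al [be Ha]] := diag_wt_ex a.
    by have [al' [be' Hc]] := diag_wt_ex c; apply: diag_wt_br Ha Hc.
  split; first by apply: diag_wt_N; apply: mem0v.
  by move=> a x y Hx Hy; have := diag_wt_lin a Hx Hy; rewrite !mulr0 !addr0.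
have step k : (derived br k.+2 <= U 0)%VS -> (derived br k.+1 <= U 0)%VS.
  move=> /subvP DN; have DD x y : x \in derived br k.+1 -> y \in derived br k.+1 -> br x y \in U 0.
    by move=> xD yD; apply: DN; apply: brsp_mem.
  have <- : (U 0 + derived br k.+1)%VS = U 0; last exact: addvSr.
  apply: nilradical_max; last 3 first.
  - exact: addvSl.
  - move=> _ _ /memv_addP[x xN [x' x'D ->]] /memv_addP[y yN [y' y'D ->]].
    rewrite (brDl Lbr) (brDr Lbr _ _ x'); apply: rpredD; first by case: (idN (y + y') xN).
    by apply: rpredD; [case: (idN x' yN) | apply: DD].
  - move=> _ /memv_addP[x xN [x' x'D ->]].
    by have := diag_wt_lin 1 (diag_wt_N xN) (D0 _ _ x'D); rewrite !mulr0 !addr0 scale1r.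
  apply/(is_idealP Lbr) => _ w /memv_addP[x xN [x' x'D ->]].
  have [h1 h2] := idN w xN.
  have /(is_idealP Lbr) H := ideal_derived Lbr k.+1.
  have [h1' h2'] := H _ w x'D.
  by split; rewrite ?(brDl Lbr) ?(brDr Lbr); apply: memv_add.
have : (derived br 1 <= U 0)%VS.
  have [k Hk] := solv.
  have : (derived br k.+1 <= U 0)%VS.
    apply: brsp_sub => // x y xD _; have : x \in derived br k := xD.
    rewrite Hk memv0 => /eqP ->.
    by rewrite (br0l Lbr) mem0v.
  by elim: k {Hk} => // k IHk /step /IHk.
by move/subvP; apply; apply: brsp_mem; rewrite ?memvf.
Qed.

(** Since every bracket lies in N, the subspace N + <u> is an ideal, and [nilradical_max] identifies
    it with N. *)
Lemma diag_wt_nil_mem u : diag_wt u 0 0 -> u \in U 0.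
Proof.
move=> Hu; have <- : (U 0 + <[u]>)%VS = U 0.
  apply: nilradical_max; first 1 last.
  - exact: addvSl.
  - by move=> *; apply: derived_sub_nilradical.
  - move=> _ /memv_addP[x xN [_ /vlineP[c ->] ->]].
    by have := diag_wt_lin c Hu (diag_wt_N xN); rewrite !mulr0 !addr0 addrC.
  apply/(is_idealP Lbr) => x w _.
  by split; apply: (subvP (addvSl _ _)); apply: derived_sub_nilradical.
by apply: (subvP (addvSr _ _)); apply: memv_line.
Qed.

End Nilradical.
End Weights.

(** * Eigenvectors of a triangular right multiplication *)

Section TriangularOperator.
Variables (F : numFieldType) (d : nat).
Notation V := 'rV[F]_d.
Variables (br : V -> V -> V) (n : nat) (b : nat -> V) (p q : nat -> nat).
Hypothesis Lbr : leibniz_algebra br.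
Notation U := (flag n b).
Variables (z : V) (al be : F).
Hypothesis Hz : diag_wt br n b p q z al be.
Notation w := (wt p q al be).
Implicit Types (c : F) (v s g : V).

(** Back substitution: the coefficient at [b k] is found by dividing by [w k - c], and the remaining
    equation lives in the next term of the flag. *)
Lemma diag_wt_surj c k : (forall j, (k <= j < n)%N -> w j != c) ->
  forall v, v \in U k -> exists2 s, s \in U k & br s z - c *: s = v.
Proof.
move: {2}(n - k)%N (leqnn (n - k)) => m; elim: m k => [|m IHm] k hm Hc v vU.
  exists 0; first exact: mem0v.
  by rewrite (br0l Lbr) scaler0 subr0 (flag_end _ vU) //; lia.
have [kn|nk] := ltnP k n; last first.
  exists 0; first exact: mem0v.
  by rewrite (br0l Lbr) scaler0 subr0 (flag_end _ vU).
have [a aU] := flag_dec kn vU.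
have wc : w k - c != 0 by rewrite subr_eq0 Hc // leqnn kn.
pose e := a / (w k - c).
have Hk := Hz kn.
have [s sU Es] : exists2 s, s \in U k.+1 &
    br s z - c *: s = (v - a *: b k) - e *: (br (b k) z - w k *: b k).
  by apply: IHm; [lia | move=> j jI; apply: Hc; lia | rewrite rpredB ?rpredZ].
exists (e *: b k + s).
  by rewrite rpredD ?rpredZ ?flag_mem ?leqnn //; apply: flagW sU; lia.
have ae : a = e * (w k - c) by rewrite /e divfK.
rewrite (brDl Lbr) (brZl Lbr) scalerDr opprD addrACA Es ae.
by apply/rowP => i; rewrite !mxE; ring.
Qed.

(** The error of [b j] as an eigenvector lies in [U j.+1]; there R_z - [w j] is onto, because only
    the later eigenvalues occur, so a correction exists. *)
Lemma diag_wt_eigvec j : (j < n)%N -> (forall l, (j < l < n)%N -> w l != w j) ->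
  exists2 g, g - b j \in U j.+1 & br g z = w j *: g.
Proof.
move=> jn Hw; have [//|s sU Es] := diag_wt_surj (c := w j) (k := j.+1) _ (rpredNr (Hz jn)).
exists (b j + s); first by rewrite addrC addKr.
apply/eqP; rewrite -subr_eq0 (brDl Lbr) scalerDr opprD addrACA Es.
by rewrite subrr.
Qed.

Hypothesis free_b : free [seq b j | j <- iota 0 n].

(** Modulo [U k.+1] the eigenvector equation says that [w k - c] kills the leading coefficient. *)
Lemma diag_wt_eig_step c k v : (k < n)%N -> w k != c -> v \in U k ->
  br v z = c *: v -> v \in U k.+1.
Proof.
move=> kn wc vU Ev; have [a aU] := flag_dec kn vU.
suff a0 : a = 0 by move: aU; rewrite a0 scale0r subr0.
have wc' : w k - c != 0 by rewrite subr_eq0.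
apply: (mulfI wc'); rewrite mulr0; apply: (flag_free free_b kn).
have h1 := diag_wt_stable Lbr Hz aU.
have h2 : a *: (br (b k) z - w k *: b k) \in U k.+1 by apply/rpredZ/Hz.
have h3 : c *: (v - a *: b k) \in U k.+1 by apply: rpredZ.
have -> : ((w k - c) * a) *: b k =
    c *: (v - a *: b k) - br (v - a *: b k) z - a *: (br (b k) z - w k *: b k).
  by rewrite (brBl Lbr) (brZl Lbr) Ev; apply/rowP => i; rewrite !mxE; ring.
by rewrite rpredB ?rpredB.
Qed.

Lemma diag_wt_eig0 c k v : (forall j, (k <= j < n)%N -> w j != c) ->
  v \in U k -> br v z = c *: v -> v = 0.
Proof.
move: {2}(n - k)%N (leqnn (n - k)) => m; elim: m k => [|m IHm] k hm Hc vU Ev.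
  by apply: flag_end vU; lia.
have [kn|nk] := ltnP k n; last exact: flag_end vU.
apply: (IHm k.+1) => //; first by lia.
  by move=> j jI; apply: Hc; lia.
by apply: diag_wt_eig_step Ev => //; apply: Hc; rewrite leqnn.
Qed.

(** The vector first descends to [U j]. Subtracting the multiple of [g] with the same leading
    coefficient leaves an eigenvector in [U j.+1], where [w j] is not an eigenvalue. *)
Lemma diag_wt_eigline j g v : (j < n)%N ->
  (forall l, (l < n)%N -> l != j -> w l != w j) ->
  g - b j \in U j.+1 -> br g z = w j *: g ->
  v \in U 0 -> br v z = w j *: v -> exists a, v = a *: g.
Proof.
move=> jn Hw gU Eg vU Ev.
have vj : v \in U j.
  have H k : (k <= j)%N -> v \in U k.
    elim: k => // k IHk kj; apply: diag_wt_eig_step Ev; [lia | | by apply: IHk; lia].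
    by apply: Hw; lia.
  exact: H.
have [a aU] := flag_dec jn vj; exists a; apply/eqP; rewrite -subr_eq0.
apply/eqP; apply: (@diag_wt_eig0 (w j) j.+1).
- by move=> l lI; apply: Hw; lia.
- have -> : v - a *: g = (v - a *: b j) - a *: (g - b j).
    by rewrite scalerBr opprB addrA subrK.
  by rewrite rpredB ?rpredZ.
- by rewrite (brBl Lbr) (brZl Lbr) Ev Eg scalerBr !scalerA mulrC.
Qed.

End TriangularOperator.

(** * The complement of the nilradical and its action *)

Section Torus.
Variables (F : numFieldType) (n : nat).
Notation V := 'rV[F]_(n + 2).
Variables (br : V -> V -> V) (b : nat -> V) (p q : nat -> nat).
Hypothesis Lbr : leibniz_algebra br.
Notation U := (flag n b).
Implicit Types (u v s t g : V) (al be : F).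
Hypothesis diag_wt_N : forall u, u \in U 0 -> diag_wt br n b p q u 0 0.
Hypothesis derived_N : forall u v, br u v \in U 0.

(* Eigenvalue on the j-th basis vector of an element with pair (1, n). *)
Definition weight j : nat := (p j + n * q j)%N.

Lemma wt_weight j : wt p q (1 : F) n%:R j = (weight j)%:R.
Proof. by rewrite /wt /weight mul1r natrD natrM. Qed.

Section Existence.
Hypothesis diag_wt_ex : forall u, exists al be, diag_wt br n b p q u al be.
Hypothesis diag_wt_nil_mem : forall u, diag_wt br n b p q u 0 0 -> u \in U 0.

(** Dimension count: the pair is a linear map to the plane with kernel inside N, which has dimension
    at most [n], while R has dimension [n + 2]. *)
Lemma diag_wt_onto al be : exists u, diag_wt br n b p q u al be.
Proof.
have H (i : 'I_(n + 2)) : exists c : 'rV[F]_2,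
    diag_wt br n b p q (delta_mx 0 i) (c 0 0) (c 0 1).
  have [a [e He]] := diag_wt_ex (delta_mx 0 i).
  by exists (\row_k (if k == 0 then a else e)); rewrite !mxE.
(* Row [i] of [A] is a pair for the [i]-th standard vector, so [u *m A] is a pair for [u]. *)
have [c Hc] := fin_all_exists H; pose A := \matrix_i c i.
have HA u : diag_wt br n b p q u ((u *m A) 0 0) ((u *m A) 0 1).
  have -> : u *m A = \sum_i u 0 i *: c i.
    by rewrite mulmx_sum_row; apply: eq_bigr => i _; rewrite rowK.
  rewrite {1}(row_sum_delta u).
  elim: index_enum => [|i r IHr].
    by rewrite !big_nil !mxE; apply: diag_wt_N; apply: mem0v.
  rewrite !big_cons !mxE; exact: diag_wt_lin.
pose B := \matrix_(i < n) b i.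
have NB u : u \in U 0 -> (u <= B)%MS.
  move: u; apply: flag_ind.
    by split=> [|a x y xB yB]; rewrite ?sub0mx // addmx_sub ?scalemx_sub.
  move=> j jn; have -> : b j = row (Ordinal jn) B by rewrite rowK.
  exact: row_sub.
have kerB : (kermx A <= B)%MS.
  apply/row_subP => i; apply/NB/diag_wt_nil_mem.
  have := HA (row i (kermx A)).
  by rewrite (sub_kermxP (row_sub i _)) !mxE.
have fullA : row_full A.
  rewrite /row_full eqn_leq rank_leq_col /=.
  have := leq_trans (mxrankS kerB) (rank_leq_row B); rewrite mxrank_ker; lia.
have /submxP[u Eu] := submx_full (\row_k (if k == 0 then al else be)) fullA.
by exists u; have := HA u; rewrite -Eu !mxE.
Qed.

Hypothesis weight_gt0 : forall j, (j < n)%N -> (0 < weight j)%N.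

(** An element [x] with the wanted pair has [x,z] in N, where R_z is onto since all weights are
    positive. Subtracting a preimage [s] in N kills [x,z] without changing the pair. *)
Lemma torus_ex : exists z x y : V,
  [/\ diag_wt br n b p q z 1 n%:R, diag_wt br n b p q x 1 0, diag_wt br n b p q y 0 1,
      br x z = 0 & br y z = 0].
Proof.
have [z Hz] := diag_wt_onto 1 n%:R.
have H al be : exists2 x, diag_wt br n b p q x al be & br x z = 0.
  have [x Hx] := diag_wt_onto al be.
  have [|s sU Es] := @diag_wt_surj _ _ _ _ _ _ _ Lbr _ _ _ Hz 0 0 _ _ (derived_N x z).
    by move=> j jn; rewrite wt_weight pnatr_eq0 -lt0n weight_gt0.
  exists (x - s).
    have := diag_wt_lin Lbr (-1) (diag_wt_N sU) Hx.
    by rewrite !mulr0 !add0r scaleN1r addrC.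
  by rewrite (brBl Lbr) -Es scale0r subr0 subrr.
have [x Hx xz] := H 1 0; have [y Hy yz] := H 0 1.
by exists z, x, y.
Qed.

End Existence.

Variable z : V.
Hypothesis Hz : diag_wt br n b p q z 1 n%:R.
Hypothesis weight_gt0 : forall j, (j < n)%N -> (0 < weight j)%N.
Hypothesis weight_inj : forall i j, (i < n)%N -> (j < n)%N -> weight i = weight j -> i = j.

Lemma weight_br u v i j : br u z = i%:R *: u -> br v z = j%:R *: v ->
  br (br u v) z = (i + j)%:R *: br u v.
Proof.
move=> Eu Ev; rewrite (br_derivation Lbr) Eu Ev (brZl Lbr) (brZr Lbr).
by rewrite -scalerDl natrD addrC.
Qed.

Lemma eigvec_ex j : (j < n)%N -> exists2 g, g - b j \in U j.+1 & br g z = (weight j)%:R *: g.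
Proof.
move=> jn; rewrite -wt_weight; apply: (diag_wt_eigvec Lbr Hz jn) => l /andP[jl ln].
rewrite !wt_weight eqr_nat; apply/eqP => /weight_inj E.
by move: jl; rewrite E // ltnn.
Qed.

Hypothesis free_b : free [seq b j | j <- iota 0 n].

Lemma no_weight m v : v \in U 0 -> br v z = m%:R *: v ->
  (forall j, (j < n)%N -> weight j != m) -> v = 0.
Proof.
move=> vU Ev Hm; apply: (diag_wt_eig0 Lbr Hz free_b _ vU Ev) => j jn.
by rewrite wt_weight eqr_nat Hm.
Qed.

(** The bracket lies in N and is killed by R_z, which has no eigenvalue 0 on N. *)
Lemma torus_br0 s t : br s z = 0 -> br t z = 0 -> br s t = 0.
Proof.
move=> sz tz; apply: (@no_weight 0) => //; last by move=> j jn; rewrite -lt0n weight_gt0.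
by rewrite (br_derivation Lbr) sz tz (br0l Lbr) (br0r Lbr) addr0 scale0r.
Qed.

Section Eigenvector.
Variables (j : nat) (g : V).
Hypotheses (jn : (j < n)%N) (gU : g - b j \in U j.+1) (Eg : br g z = (weight j)%:R *: g).

Lemma eigline v : v \in U 0 -> br v z = (weight j)%:R *: v -> exists a, v = a *: g.
Proof.
move=> vU Ev; apply: (diag_wt_eigline Lbr Hz free_b jn _ gU _ vU); last 2 first.
- by rewrite wt_weight.
- by rewrite wt_weight.
move=> l ln; apply: contraNneq => /eqP; rewrite !wt_weight eqr_nat => /eqP/weight_inj.
by move=> ->.
Qed.

Lemma eigvec_memN : g \in U 0.
Proof.
rewrite -(subrK (b j) g) rpredD //; first exact: flagW gU.
by apply: flag_mem; rewrite jn.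
Qed.

Lemma eigvec_neq0 : g != 0.
Proof.
apply: contraTneq (oner_neq0 F) => g0; rewrite negbK; apply/eqP/(flag_free free_b jn).
by rewrite scale1r -(opprK (b j)) rpredN -[- b j]add0r -g0.
Qed.

Lemma eigvec_coef a v : v - a *: b j \in U j.+1 -> (exists c, v = c *: g) -> v = a *: g.
Proof.
move=> aU [c Ec]; rewrite Ec; congr (_ *: _).
apply: (flag_coef free_b jn _ aU); rewrite Ec -scalerBr; exact: rpredZ.
Qed.

(** As [t,z] = 0, right multiplication by [t] commutes with R_z and preserves the eigenline of [g];
    the leading term gives the scalar. *)
Lemma torus_right t al be : br t z = 0 -> diag_wt br n b p q t al be ->
  br g t = wt p q al be j *: g.
Proof.
move=> tz Ht; apply: eigvec_coef; last first.
  apply: eigline => //.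
  by rewrite (br_derivation Lbr) tz (br0r Lbr) add0r Eg (brZl Lbr).
have -> : br g t - wt p q al be j *: b j =
    br (g - b j) t + (br (b j) t - wt p q al be j *: b j).
  by rewrite (brBl Lbr) addrA subrK.
by apply: rpredD; [exact: (diag_wt_stable Lbr Ht gU) | exact: Ht].
Qed.

(* [v,[t,g] + [g,t]] = 0 and [t,g] + [g,t] is a multiple of g. *)
Lemma torus_left t al be v : br t z = 0 -> diag_wt br n b p q t al be ->
  br v g != 0 -> br t g = - br g t.
Proof.
move=> tz Ht vg; rewrite (torus_right tz Ht).
have [c Ec] : exists c, br t g = c *: g.
  apply: eigline => //.
  by rewrite (br_derivation Lbr) tz (br0l Lbr) addr0 Eg (brZr Lbr).
have := br_sym_annr Lbr v t g; rewrite (torus_right tz Ht) Ec -scalerDl (brZr Lbr).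
by move/eqP; rewrite scaler_eq0 (negPf vg) orbF addr_eq0 => /eqP ->; rewrite scaleNr.
Qed.

End Eigenvector.

(** Serves the eigenvectors that are central in N, for which no element of N provides the nonzero
    bracket asked by [torus_left]; they are brackets of vectors already treated. *)
Lemma antisym_br t u v : (forall x y, x \in U 0 -> y \in U 0 -> br x y = - br y x) ->
  u \in U 0 -> v \in U 0 ->
  br t u = - br u t -> br t v = - br v t -> br t (br u v) = - br (br u v) t.
Proof.
move=> anti uN vN tu tv; rewrite (br_br Lbr) (br_derivation Lbr u) tu tv !(brNl Lbr) opprK.
by rewrite (anti u (br v t)) // opprD opprK addrC.
Qed.

End Torus.

(** * Isomorphisms with algebras given by structure constants *)

Section StructureConstants.
Variable F : numFieldType.

Lemma ee_delta m (i : 'I_m) : ee F m i.+1 = delta_mx 0 i.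
Proof. by apply/rowP => j; rewrite !mxE eqxx eqSS. Qed.

Lemma sum_ee m d (Q : 'M[F]_(m, d)) (u : 'rV[F]_m) :
  u *m Q = \sum_i u 0 i *: (ee F m i.+1 *m Q).
Proof.
rewrite mulmx_sum_row; apply: eq_bigr => i _.
by rewrite ee_delta -rowE.
Qed.

Lemma sc_bracket_ee m (c : nat -> nat -> 'rV[F]_m) a b :
  (1 <= a <= m)%N -> (1 <= b <= m)%N -> sc_bracket c (ee F m a) (ee F m b) = c a b.
Proof.
case: a => // a; case: b => // b /= am bm.
rewrite /sc_bracket (bigD1 (Ordinal am)) //= (bigD1 (Ordinal bm)) //= !mxE !eqxx mulr1 scale1r.
rewrite big1 ?addr0 => [|j jb]; last first.
  rewrite !mxE; suff /negPf -> : j.+1 != b.+1 by rewrite mulr0 scale0r.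
  by rewrite eqSS.
rewrite big1 ?addr0 // => i ia; rewrite big1 // => j _.
rewrite !mxE; suff /negPf -> : i.+1 != a.+1 by rewrite mul0r scale0r.
by rewrite eqSS.
Qed.

Lemma alg_iso_sc m (br : 'rV[F]_m -> 'rV[F]_m -> 'rV[F]_m) (c : nat -> nat -> 'rV[F]_m)
    (Q : 'M[F]_m) : leibniz_algebra br -> row_full Q ->
  (forall a b, (1 <= a <= m)%N -> (1 <= b <= m)%N ->
     br (ee F m a *m Q) (ee F m b *m Q) = c a b *m Q) ->
  alg_iso br (sc_bracket c).
Proof.
(* [Q] sends the standard basis to a basis of [br] obeying the table; the isomorphism goes the other
   way, hence the inverse. *)
move=> Lbr; rewrite row_full_unit => uQ H; exists (invmx Q); rewrite unitmx_inv; split=> // u v.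
rewrite -{1}(mulmxKV uQ u) -{1}(mulmxKV uQ v).
set u' := u *m _; set v' := v *m _.
apply: (canLR (mulmxK uQ)).
rewrite [u' *m Q]sum_ee [v' *m Q]sum_ee (br_suml Lbr) /sc_bracket mulmx_suml.
apply: eq_bigr => i _; rewrite (br_sumr Lbr) scaler_sumr mulmx_suml.
by apply: eq_bigr => j _; rewrite scalerA H ?ltn_ord // scalemxAl.
Qed.

Lemma alg_iso_extc n (br : 'rV[F]_(n + 2) -> 'rV[F]_(n + 2) -> 'rV[F]_(n + 2))
    base wx wy (g : nat -> 'rV[F]_(n + 2)) (x y : 'rV[F]_(n + 2)) (Q : 'M[F]_(n + 2)) :
  leibniz_algebra br -> row_full Q ->
  (forall a, (1 <= a <= n)%N -> ee F (n + 2) a *m Q = g a) ->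
  ee F (n + 2) n.+1 *m Q = x -> ee F (n + 2) n.+2 *m Q = y ->
  (forall a b, (1 <= a <= n)%N -> (1 <= b <= n)%N -> br (g a) (g b) = base a b *m Q) ->
  (forall a, (1 <= a <= n)%N -> br (g a) x = wx a *: g a /\ br x (g a) = - br (g a) x) ->
  (forall a, (1 <= a <= n)%N -> br (g a) y = wy a *: g a /\ br y (g a) = - br (g a) y) ->
  br x x = 0 -> br x y = 0 -> br y x = 0 -> br y y = 0 ->
  alg_iso br (sc_bracket (extc base wx wy)).
Proof.
move=> Lbr fQ Hg Hx Hy Hb Hwx Hwy xx xy yx yy.
apply: (alg_iso_sc Lbr fQ) => a c am cm.
have split3 k : (1 <= k <= n + 2)%N -> [\/ (1 <= k <= n)%N, k = n.+1 | k = n.+2].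
  move=> kI; have [|] := leqP k n => h; first by constructor 1; lia.
  by have [|] := eqVneq k n.+1 => h'; [constructor 2 | constructor 3; lia].
have f1 : (n.+1 <= n)%N = false by lia.
have f2 : (n.+2 <= n)%N = false by lia.
have f3 : (n.+2 == n.+1) = false by lia.
have f4 : (n.+1 == n.+2) = false by lia.
rewrite /extc; case: (split3 _ am) => [aI|->|->]; case: (split3 _ cm) => [cI|->|->];
  rewrite ?Hx ?Hy ?Hg // ?f1 ?f2 ?f3 ?f4 ?eqxx ?andbF ?andbT /= ?mul0mx //.
- by have /andP[_ ->] := aI; have /andP[_ ->] := cI; rewrite Hb.
- by rewrite aI -scalemxAl Hg //; case: (Hwx a aI).
- by rewrite aI -scalemxAl Hg //; case: (Hwy a aI).
- by rewrite cI /= mulNmx -scalemxAl Hg //; case: (Hwx c cI) => <- ->.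
- by rewrite cI /= mulNmx -scalemxAl Hg //; case: (Hwy c cI) => <- ->.
Qed.

(** The reordering [s] makes the action on the nilradical triangular: it is [succn] for g^1 and [s2]
    for g^2. *)
Lemma sub_iso_basis n d (N : {vspace 'rV[F]_d}) (M : 'M[F]_(n, d)) (s : nat -> nat) :
  row_free M -> (forall u, u *m M \in N) -> \dim N = n ->
  (forall j, (j < n)%N -> (1 <= s j <= n)%N) ->
  (forall i j, (i < n)%N -> (j < n)%N -> s i = s j -> i = j) ->
  let b j := ee F n (s j) *m M in
  free [seq b j | j <- iota 0 n] /\ N = flag n b 0.
Proof.
move=> fM MN dN s_range s_inj b.
have fr : free [seq b j | j <- iota 0 n].
  have -> : [seq b j | j <- iota 0 n] = [tuple b (val j) | j < n].
    by rewrite /= -val_enum_ord -map_comp.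
  apply/freeP => k Hk i.
  have : (\sum_j k j *: ee F n (s j)) *m M = 0 *m M.
    rewrite mul0mx -{}[RHS]Hk mulmx_suml; apply: eq_bigr => j _.
    by rewrite -tnth_nth tnth_mktuple scalemxAl.
  move/(row_free_inj fM) => Hs.
  have /andP[si1 sin] := s_range i (ltn_ord i).
  have si : ((s i).-1 < n)%N by lia.
  (* The vectors [ee] count from 1 and matrix columns from 0, so the coordinate of e_(s i) is
     [(s i).-1]. *)
  have := congr1 (fun A : 'rV[F]_n => A 0 (Ordinal si)) Hs.
  rewrite summxE (bigD1 i) //= big1 ?addr0 => [|j ji]; rewrite !mxE /= prednK //.
    by rewrite eqxx mulr1.
  suff /negPf -> : s i != s j by rewrite mulr0.
  by apply: contraNneq ji => /s_inj E; apply/eqP/val_inj/esym/E.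
split=> //; apply/esym/eqP; rewrite eqEdim; apply/andP; split.
  by apply/subvP; apply: flag_ind => [|j _]; [exact: lin_closed_mem | exact: MN].
rewrite /flag subn0 dN; move: fr; rewrite /free => /eqP ->.
by rewrite size_map size_iota.
Qed.

End StructureConstants.

(** * Checking brackets on the vectors of a flag *)

Section FlagBracket.
Variables (F : numFieldType) (d : nat).
Notation V := 'rV[F]_d.
Variables (br : V -> V -> V) (n : nat) (b : nat -> V).
Hypothesis Lbr : leibniz_algebra br.
Notation U := (flag n b).

Lemma br_flag k l (W : {vspace V}) :
  (forall i j, (k <= i < n)%N -> (l <= j < n)%N -> br (b i) (b j) \in W) ->
  forall u v, u \in U k -> v \in U l -> br u v \in W.
Proof.
move=> H u v uU vU; move: u uU.
apply: flag_ind; first exact: lin_closed_brl (lin_closed_mem _).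
move=> i iI; move: v vU.
apply: flag_ind; first exact: lin_closed_brr (lin_closed_mem _).
by move=> j jI; apply: H.
Qed.

Lemma antisym_flag : (forall i j, (i < n)%N -> (j < n)%N -> br (b i) (b j) = - br (b j) (b i)) ->
  forall u v, u \in U 0 -> v \in U 0 -> br u v = - br v u.
Proof.
have cl w : lin_closed (fun u => br u w = - br w u).
  split; first by rewrite (br0l Lbr) (br0r Lbr) oppr0.
  by move=> a x y Hx Hy; rewrite (brDl Lbr) (brDr Lbr) (brZl Lbr) (brZr Lbr) Hx Hy opprD scalerN.
move=> H u v uU vU; move: u uU; apply: flag_ind => // i iI.
apply/eqP; rewrite -eqr_oppLR; apply/eqP/esym.
by move: v vU; apply: flag_ind => // j jI; apply: H.
Qed.

Lemma antisym_alt u : br u u = - br u u -> br u u = 0.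
Proof.
move/eqP; rewrite -addr_eq0 -mulr2n -scaler_nat scaler_eq0 pnatr_eq0 /=.
by move/eqP.
Qed.

End FlagBracket.

(** * From an adapted basis to the isomorphism *)

Section Assembly.
Variables (F : numFieldType) (n : nat).
Notation V := 'rV[F]_(n + 2).
Variables (br : V -> V -> V) (b : nat -> V) (p q s : nat -> nat).
Hypothesis Lbr : leibniz_algebra br.
Notation U := (flag n b).
Notation weight := (weight n p q).
Hypothesis free_b : free [seq b j | j <- iota 0 n].
Hypothesis derived_N : forall u v, br u v \in U 0.
Hypothesis diag_wt_ex : forall u, exists al be, diag_wt br n b p q u al be.
Hypothesis diag_wt_nil_mem : forall u, diag_wt br n b p q u 0 0 -> u \in U 0.
Hypothesis weight_gt0 : forall j, (j < n)%N -> (0 < weight j)%N.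
Hypothesis weight_inj : forall i j, (i < n)%N -> (j < n)%N -> weight i = weight j -> i = j.
Variables (z x y : V).
Hypothesis Hz : diag_wt br n b p q z 1 n%:R.
Hypothesis Hx : diag_wt br n b p q x 1 0.
Hypothesis Hy : diag_wt br n b p q y 0 1.
Hypotheses (xz : br x z = 0) (yz : br y z = 0).
Hypothesis s_range : forall j, (j < n)%N -> (1 <= s j <= n)%N.
Hypothesis s_surj : forall a, (1 <= a <= n)%N -> exists2 j, (j < n)%N & s j = a.
Variable g : nat -> V.
Hypothesis gU : forall j, (j < n)%N -> g (s j) - b j \in U j.+1.
Hypothesis g_eig : forall j, (j < n)%N -> br (g (s j)) z = (weight j)%:R *: g (s j).
Variables (base : nat -> nat -> V) (wx wy : nat -> F).
Hypothesis wxE : forall j, (j < n)%N -> wx (s j) = (p j)%:R.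
Hypothesis wyE : forall j, (j < n)%N -> wy (s j) = (q j)%:R.
Hypothesis baseE : forall Q : 'M[F]_(n + 2),
  (forall a, (1 <= a <= n)%N -> ee F (n + 2) a *m Q = g a) ->
  forall a c, (1 <= a <= n)%N -> (1 <= c <= n)%N -> br (g a) (g c) = base a c *m Q.
Hypothesis g_left : forall t al be, br t z = 0 -> diag_wt br n b p q t al be ->
  forall a, (1 <= a <= n)%N -> br t (g a) = - br (g a) t.

Lemma alg_iso_torus : alg_iso br (sc_bracket (extc base wx wy)).
Proof.
pose G a := if (a <= n)%N then g a else if a == n.+1 then x else y.
pose Q : 'M[F]_(n + 2) := \matrix_i G i.+1.
have GQ a : (1 <= a <= n + 2)%N -> ee F (n + 2) a *m Q = G a.
  by case: a => // a /= an; rewrite (ee_delta F (Ordinal an)) -rowE rowK.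
have gQ a : (1 <= a <= n)%N -> ee F (n + 2) a *m Q = g a.
  by move=> aI; rewrite GQ /G; [case/andP: aI => _ -> | lia].
have xQ : ee F (n + 2) n.+1 *m Q = x by rewrite GQ /G ?ltnn ?eqxx //; lia.
have yQ : ee F (n + 2) n.+2 *m Q = y.
  rewrite GQ /G; last by lia.
  by rewrite !ifF //; lia.
(* The [g (s j)] are unitriangular over the [b j], so by elimination along the flag they span N. *)
have UQ k v : v \in U k -> (v <= Q)%MS.
  move: {2}(n - k)%N (leqnn (n - k)) => m; elim: m k v => [|m IHm] k v hm vU.
    by rewrite (flag_end _ vU) ?sub0mx //; lia.
  have [kn|nk] := ltnP k n; last by rewrite (flag_end nk vU) sub0mx.
  have [a aU] := flag_dec kn vU.
  have -> : v = a *: g (s k) + ((v - a *: b k) - a *: (g (s k) - b k)).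
    by apply/rowP => i; rewrite !mxE; ring.
  rewrite addmx_sub ?scalemx_sub //.
    by rewrite -gQ ?submxMl //; apply: s_range.
  apply: (IHm k.+1); first by lia.
  by rewrite rpredB // rpredZ // gU.
(* Removing [al *: x + be *: y] from a vector with pair (al, be) leaves the pair (0, 0), hence an
   element of N, already covered by [UQ]. *)
have fQ : row_full Q.
  rewrite -sub1mx; apply/row_subP => i; move: (row i _) => v.
  have [al [be Hv]] := diag_wt_ex v.
  have := diag_wt_lin Lbr (- be) Hy (diag_wt_lin Lbr (- al) Hx Hv).
  rewrite !mulr1 !mulr0 !add0r !addNr => /diag_wt_nil_mem /UQ h.
  have -> : v = al *: x + (be *: y + (- be *: y + (- al *: x + v))).
    by apply/rowP => k; rewrite !mxE; ring.
  rewrite addmx_sub ?scalemx_sub //; first by rewrite -xQ submxMl.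
  by rewrite addmx_sub ?scalemx_sub // -yQ submxMl.
have br0 := torus_br0 Lbr derived_N Hz weight_gt0 free_b.
apply: (alg_iso_extc Lbr fQ gQ xQ yQ); last 4 first; try exact: br0.
- exact: baseE gQ.
- move=> a aI; split; last exact: g_left Hx _ aI.
  have [j jn <-] := s_surj aI; rewrite wxE //.
  rewrite (torus_right Lbr derived_N Hz weight_inj free_b jn (gU jn) (g_eig jn) xz Hx).
  by rewrite /wt mul1r mul0r addr0.
- move=> a aI; split; last exact: g_left Hy _ aI.
  have [j jn <-] := s_surj aI; rewrite wyE //.
  rewrite (torus_right Lbr derived_N Hz weight_inj free_b jn (gU jn) (g_eig jn) yz Hy).
  by rewrite /wt mul1r mul0r add0r.
Qed.

End Assembly.

(** * The multiplication tables as relations *)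

Section Tables.
Variables (F : numFieldType) (n d : nat).
Notation V := 'rV[F]_d.
Variables (br : V -> V -> V) (e : nat -> V).

(* The constants g1c, g2c read on an arbitrary family e instead of the basis ee. *)
Definition g1_table a b : V :=
  if (a == 1%N) && (2 <= b <= n - 2)%N then e b.+1
  else if (b == 1%N) && (2 <= a <= n - 2)%N then - e a.+1
  else if (2 <= a <= (n - 1)./2)%N && (b == n - a)%N then (-1) ^+ a *: e n
  else if (2 <= b <= (n - 1)./2)%N && (a == n - b)%N then - ((-1) ^+ b *: e n)
  else 0.

Definition g2_table a b : V :=
  if (a == 1%N) && (2 <= b <= n - 2)%N then e b.+1
  else if (b == 1%N) && (2 <= a <= n - 2)%N then - e a.+1
  else if (2 <= a <= n - 3)%N && (b == n) then e a.+2
  else if (a == n) && (2 <= b <= n - 3)%N then - e b.+2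
  else 0.

Definition antisym_rel := forall a b, (1 <= a <= n)%N -> (1 <= b <= n)%N ->
  br (e a) (e b) = - br (e b) (e a).

(** For odd [n] the signs (-1)^i are compatible with antisymmetry, so one relation covers all [i]
    from 2 to n - 2 instead of the two halves of the table. *)
Definition g1_rel : Prop :=
  [/\ antisym_rel,
      forall i, (2 <= i <= n - 2)%N -> br (e 1) (e i) = e i.+1,
      forall i, (n - 1 <= i <= n)%N -> br (e 1) (e i) = 0,
      forall i j, (2 <= i <= n)%N -> (2 <= j <= n)%N -> (i + j != n)%N -> br (e i) (e j) = 0 &
      forall i, (2 <= i <= n - 2)%N -> br (e i) (e (n - i)%N) = (-1) ^+ i *: e n].

Definition g2_rel : Prop :=
  [/\ antisym_rel,
      forall i, (2 <= i <= n - 2)%N -> br (e 1) (e i) = e i.+1,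
      forall i, (n - 1 <= i <= n)%N -> br (e 1) (e i) = 0,
      forall i j, (2 <= i < n)%N -> (2 <= j < n)%N -> br (e i) (e j) = 0 &
      (forall i, (2 <= i <= n - 3)%N -> br (e i) (e n) = e i.+2) /\
      (forall i, (n - 2 <= i < n)%N -> br (e i) (e n) = 0)].

Hypothesis n5 : (5 < n)%N.

Lemma g1_table_antisym a b : g1_table a b = - g1_table b a.
Proof.
rewrite /g1_table; repeat (case: ifP => ?);
  rewrite ?opprK ?oppr0 //; lia.
Qed.

Lemma g2_table_antisym a b : g2_table a b = - g2_table b a.
Proof.
rewrite /g2_table; repeat (case: ifP => ?);
  rewrite ?opprK ?oppr0 //; lia.
Qed.

Lemma g1_rel_table : odd n ->
  (forall a b, (1 <= a <= n)%N -> (1 <= b <= n)%N -> br (e a) (e b) = g1_table a b) -> g1_rel.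
Proof.
move=> on H; split.
- by move=> a b aI bI; rewrite !H // g1_table_antisym.
- by move=> i iI; rewrite H /g1_table ?ifT //; lia.
- by move=> i iI; rewrite H /g1_table ?ifF //; lia.
- by move=> i j iI jI ij; rewrite H /g1_table ?ifF //; lia.
- move=> i iI; rewrite H; try lia; rewrite /g1_table.
  rewrite ifF; last lia. rewrite ifF; last lia.
  case: ifP => [//|c1]; rewrite ifT; last lia.
  (* Here [i] is in the upper half and the table gives -(-1)^(n-i), which is (-1)^i because [n] is
     odd. *)
  rewrite -scaleNr; congr (_ *: _).
  rewrite -signr_odd oddB ?on; last lia.
  by rewrite -[in RHS]signr_odd; case: (odd i); rewrite ?expr0 ?expr1 ?opprK.
Qed.

Lemma g2_rel_table :
  (forall a b, (1 <= a <= n)%N -> (1 <= b <= n)%N -> br (e a) (e b) = g2_table a b) -> g2_rel.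
Proof.
move=> H; split.
- by move=> a b aI bI; rewrite !H // g2_table_antisym.
- by move=> i iI; rewrite H /g2_table ?ifT //; lia.
- by move=> i iI; rewrite H /g2_table ?ifF //; lia.
- by move=> i j iI jI; rewrite H /g2_table ?ifF //; lia.
- split=> i iI; rewrite H /g2_table; try lia; last by rewrite !ifF //; lia.
  by rewrite ifF; [rewrite ifF; [rewrite ifT //; lia | lia] | lia].
Qed.

Lemma table_g1_rel : odd n -> g1_rel ->
  forall a b, (1 <= a <= n)%N -> (1 <= b <= n)%N -> br (e a) (e b) = g1_table a b.
Proof.
move=> on [anti H1 H2 H3 H4] a b aI bI; rewrite /g1_table.
case: ifP => c1; first by have /andP[/eqP-> ?] := c1; rewrite H1.
case: ifP => c2; first by have /andP[/eqP-> ?] := c2; rewrite anti ?H1 //; lia.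
case: ifP => c3; first by have /andP[? /eqP->] := c3; rewrite H4 //; lia.
case: ifP => c4; first by have /andP[? /eqP->] := c4; rewrite anti ?H4 //; lia.
have [a1|a1] := eqVneq a 1%N; last have [b1|b1] := eqVneq b 1%N.
- rewrite a1; have [b1|b1] := eqVneq b 1%N; last by apply: H2; lia.
  by rewrite b1; apply: antisym_alt; apply: anti; lia.
- by rewrite b1 anti // ?H2 ?oppr0 //; lia.
- by apply: H3; lia.
Qed.

Lemma table_g2_rel : g2_rel ->
  forall a b, (1 <= a <= n)%N -> (1 <= b <= n)%N -> br (e a) (e b) = g2_table a b.
Proof.
move=> [anti H1 H2 H3 [H4 H5]] a b aI bI; rewrite /g2_table.
case: ifP => c1; first by have /andP[/eqP-> ?] := c1; rewrite H1.
case: ifP => c2; first by have /andP[/eqP-> ?] := c2; rewrite anti ?H1 //; lia.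
case: ifP => c3; first by have /andP[? /eqP->] := c3; rewrite H4 //; lia.
case: ifP => c4; first by have /andP[/eqP-> ?] := c4; rewrite anti ?H4 //; lia.
have [->|ab] := eqVneq a b; first by apply: antisym_alt; apply: anti.
have [a1|a1] := eqVneq a 1%N; first by rewrite a1; apply: H2; lia.
have [b1|b1] := eqVneq b 1%N; first by rewrite b1 anti // ?H2 ?oppr0 //; lia.
have [an|an] := eqVneq a n; first by rewrite an anti // ?H5 ?oppr0 //; lia.
have [bn|bn] := eqVneq b n; first by rewrite bn; apply: H5; lia.
by apply: H3; lia.
Qed.

End Tables.

Section TablesExt.
Variables (F : numFieldType) (n d : nat) (e e' : nat -> 'rV[F]_d).
Hypotheses (n5 : (5 < n)%N) (ee' : forall k, (1 <= k <= n)%N -> e k = e' k).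

Lemma g1_table_ext a b : g1_table n e a b = g1_table n e' a b.
Proof. by rewrite /g1_table; repeat (case: ifP => ?); rewrite ?ee' //; lia. Qed.

Lemma g2_table_ext a b : g2_table n e a b = g2_table n e' a b.
Proof. by rewrite /g2_table; repeat (case: ifP => ?); rewrite ?ee' //; lia. Qed.

End TablesExt.

Section StructureConstantsTables.
Variables (F : numFieldType) (n m d : nat) (Q : 'M[F]_(m, d)).

Lemma g1c_mul a b : g1c F m n a b *m Q = g1_table n (fun k => ee F m k *m Q) a b.
Proof.
by rewrite /g1c /g1_table; repeat (case: ifP => _); rewrite ?mulNmx -?scalemxAl ?mul0mx.
Qed.

Lemma g2c_mul a b : g2c F m n a b *m Q = g2_table n (fun k => ee F m k *m Q) a b.
Proof.
by rewrite /g2c /g2_table; repeat (case: ifP => _); rewrite ?mulNmx -?scalemxAl ?mul0mx.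
Qed.

End StructureConstantsTables.

(** * Nilradical of type g^1 *)

(* 0-based: position j holds e_(j+1), which has weight p1 j * al + q1 j * be. *)
Definition p1 n j := (if j == 0 then 1 else if j < n - 1 then j - 1 else n - 4)%N.
Definition q1 n j := (if j == 0 then 0 else if j < n - 1 then 1 else 2)%N.

Lemma weight1_gt0 n j : (5 < n)%N -> (j < n)%N -> (0 < weight n (p1 n) (q1 n) j)%N.
Proof. by move=> n5; rewrite /weight /p1 /q1; case: ifP => ?; [|case: ifP => ?]; lia. Qed.

(** In order, the weights are 1, then n, ..., 2n - 3, then 3n - 4. *)
Lemma weight1_inj n i j : (5 < n)%N -> (i < n)%N -> (j < n)%N ->
  weight n (p1 n) (q1 n) i = weight n (p1 n) (q1 n) j -> i = j.
Proof.
by move=> n5; rewrite /weight /p1 /q1; case: ifP => ?; [|case: ifP => ?];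
  case: ifP => ?; [|case: ifP => ?| |case: ifP => ?| |case: ifP => ?]; lia.
Qed.

Section G1.
Variables (F : numFieldType) (n : nat).
Notation V := 'rV[F]_(n + 2).
Variables (br : V -> V -> V) (e : nat -> V).
Hypotheses (Lbr : leibniz_algebra br) (n5 : (5 < n)%N).
Hypothesis rel : g1_rel n br e.

Notation p1 := (p1 n).
Notation q1 := (q1 n).

Definition b1 j := e j.+1.
Notation U := (flag n b1).

Let e_mem i k : (k < i <= n)%N -> e i \in U k.
Proof. by case: i => // i iI; apply: (flag_mem b1); lia. Qed.

Lemma g1_br_e1 k v : (1 <= k)%N -> v \in U k -> br (e 1) v \in U k.+1.
Proof.
case: rel => _ H1 H2 _ _ k1; move: v.
apply: flag_ind; first exact: lin_closed_brr (lin_closed_mem _).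
move=> j jI; rewrite /b1; have [h|h] := leqP j.+1 (n - 2).
  by rewrite H1; [apply: e_mem | ]; lia.
by rewrite H2 ?mem0v //; lia.
Qed.

(** Away from e_1 the only nonzero brackets are multiples of e_n, which spans [U n.-1]. *)
Lemma g1_br_high k l u v : (1 <= k)%N -> (1 <= l)%N -> u \in U k -> v \in U l ->
  br u v \in U n.-1.
Proof.
case: rel => _ _ _ H3 H4 k1 l1; apply: (br_flag Lbr) => i j iI jI; rewrite /b1.
have [h|h] := eqVneq (i.+1 + j.+1)%N n; last by rewrite H3 ?mem0v //; lia.
have -> : j.+1 = (n - i.+1)%N by lia.
by rewrite H4; [apply/rpredZ/e_mem | ]; lia.
Qed.

(** Positions [k] and [l] hold e_(k+1) and e_(l+1), so all index sums are at least [k + l + 2] and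
    never equal [n]. *)
Lemma g1_br_high0 k l u v : (1 <= k)%N -> (1 <= l)%N -> (n < k + l + 2)%N ->
  u \in U k -> v \in U l -> br u v = 0.
Proof.
case: rel => _ _ _ H3 _ k1 l1 kl uU vU; apply/eqP; rewrite -memv0.
move: u v uU vU; apply: (br_flag Lbr) => i j iI jI.
by rewrite /b1 H3 ?mem0v //; lia.
Qed.

Lemma g1_diag_wt_N u : u \in U 0 -> diag_wt br n b1 p1 q1 u 0 0.
Proof.
move=> uU; apply/diag_wt_nilP => j jn; move: u uU.
apply: flag_ind; first exact: lin_closed_brr (lin_closed_mem _).
move=> k kn; case: (rel) => anti H1 H2 _ _.
have [j0|j0] := posnP j.
  rewrite j0 /b1; have [->|k0] := posnP k.
    by rewrite antisym_alt ?mem0v //; apply: anti; lia.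
  by apply: flagW (g1_br_e1 k0 (e_mem _)); lia.
have [->|k0] := posnP k.
  by rewrite /b1 anti ?rpredN; try lia; apply: (g1_br_e1 j0 (e_mem _)); lia.
have [jn1|jn1] := eqVneq j n.-1.
  rewrite (@g1_br_high0 j k) ?mem0v //; try lia; apply: e_mem; lia.
by apply: flagW (g1_br_high j0 k0 (e_mem _) (e_mem _)); lia.
Qed.

Hypothesis idN : forall u v, u \in U 0 -> br u v \in U 0.
Hypothesis free_b : free [seq b1 j | j <- iota 0 n].

(** R_u is a derivation of N, determined by its values on the generators e_1 and e_2. Their diagonal
    coefficients are the pair, and the others follow from e_(k+1) = [e_1,e_k] and e_n =
    [e_2,e_(n-2)]. *)
Lemma g1_diag_wt_ex u : exists al be, diag_wt br n b1 p1 q1 u al be.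
Proof.
case: (rel) => anti H1 H2 H3 H4.
have D v w : br (br v w) u = br v (br w u) + br (br v u) w by apply: br_derivation.
have n0 : (0 < n)%N by lia.
have n1 : (1 < n)%N by lia.
have e1U : br (e 1) u \in U 0 by apply/idN/e_mem; lia.
have e2U : br (e 2) u \in U 0 by apply/idN/e_mem; lia.
have [a Ha] := flag_dec n0 e1U.
have [dd Hd] := flag_dec n0 e2U.
have [be Hb] := flag_dec n1 Hd.
pose s := br (e 1) u - a *: e 1; have {}Ha : s \in U 1 := Ha.
pose t := br (e 2) u - dd *: e 1 - be *: e 2; have {}Hb : t \in U 2 := Hb.
have E1 : br (e 1) u = a *: e 1 + s by rewrite /s addrC subrK.
have E2 : br (e 2) u = dd *: e 1 + be *: e 2 + t.
  by rewrite /t; apply/rowP => i; rewrite !mxE; ring.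
clearbody s t.
have e11 : br (e 1) (e 1) = 0 by apply: antisym_alt; apply: anti; lia.
have e3 : e 3 = br (e 1) (e 2) by rewrite H1 //; lia.
have D3 : br (e 3) u - (be + a) *: e 3 \in U 3.
  have -> : br (e 3) u - (be + a) *: e 3 = br (e 1) t + br s (e 2).
    rewrite {1}e3 D E1 E2 !(brDr Lbr) !(brDl Lbr) !(brZr Lbr) !(brZl Lbr) e11 -e3 .
    by apply/rowP => i; rewrite !mxE; ring.
  rewrite rpredD //; first exact: g1_br_e1.
  by apply: flagW (g1_br_high _ _ Ha (e_mem (_ : 1 < 2 <= n)%N)) => //; lia.
(* The e_1-component of [e_2,u] would break triangularity. Applying R_u to [e_2,e_3] = 0 exhibits
   [dd] as the coefficient of e_4 modulo later vectors. *)
have dd0 : dd = 0.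
  have n3 : (3 < n)%N by lia.
  apply: (flag_free free_b n3).
  have e4 : e 4 = br (e 1) (e 3) by rewrite H1 //; lia.
  have e23 : br (e 2) (e 3) = 0 by apply: H3; lia.
  set r := _ - _ in D3; have E3 : br (e 3) u = (be + a) *: e 3 + r by rewrite addrC subrK.
  have := D (e 2) (e 3); rewrite e23 (br0l Lbr) E2 E3.
  rewrite (brDr Lbr) !(brDl Lbr) !(brZr Lbr) !(brZl Lbr) -e4 e23 => E.
  have -> : dd *: b1 3 = - (br (e 2) r + br t (e 3)).
    move/rowP: E => E; apply/rowP => i; have := E i; rewrite !mxE => E'.
    apply/eqP; rewrite -subr_eq0 opprK; apply/eqP; rewrite [RHS]E' /b1; ring.
  rewrite rpredN rpredD //.
    by apply: flagW (g1_br_high _ _ (e_mem (_ : 1 < 2 <= n)%N) D3) => //; lia.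
  by apply: flagW (g1_br_high _ _ Hb (e_mem (_ : 2 < 3 <= n)%N)) => //; lia.
have Dc k : (k.+2 <= n - 1)%N -> br (e k.+2) u - (be + a * k%:R) *: e k.+2 \in U k.+2.
  elim: k => [|k IHk] kn.
    by rewrite E2 dd0 mulr0 addr0 scale0r add0r addrAC subrr add0r.
  have {}IHk := IHk (ltnW kn).
  have ek : e k.+3 = br (e 1) (e k.+2) by rewrite H1 //; lia.
  set r := _ - _ in IHk; have Ek : br (e k.+2) u = (be + a * k%:R) *: e k.+2 + r.
    by rewrite addrC subrK.
  have -> : br (e k.+3) u - (be + a * k.+1%:R) *: e k.+3 = br (e 1) r + br s (e k.+2).
    rewrite {1}ek D E1 Ek !(brDr Lbr) !(brDl Lbr) !(brZr Lbr) !(brZl Lbr) -ek -natr1.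
    by apply/rowP => i; rewrite !mxE; ring.
  rewrite rpredD //; first exact: g1_br_e1.
  by apply: flagW (g1_br_high _ _ Ha (e_mem (_ : 1 < k.+2 <= n)%N)) => //; lia.
(* The weights of e_2 and e_(n-2) add up. The equality is exact, since brackets with the remainders
   have index sums above [n]. *)
have Dn : br (e n) u = (be *+ 2 + a * (n - 4)%:R) *: e n.
  have n4 : (n - 2 = (n - 4).+2)%N by lia.
  have en : e n = br (e 2) (e (n - 4).+2) by rewrite -n4 H4 ?expr2 ?mulrN1 ?opprK ?scale1r //; lia.
  have := Dc (n - 4)%N; set r := _ - _ => Hr.
  have rU : r \in U (n - 4).+2 by apply: Hr; lia.
  have Ek : br (e (n - 4).+2) u = (be + a * (n - 4)%:R) *: e (n - 4).+2 + r.
    by rewrite addrC subrK.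
  clearbody r; rewrite {1}en D E2 Ek dd0 !(brDr Lbr) !(brDl Lbr) !(brZr Lbr) !(brZl Lbr) -en.
  rewrite (@g1_br_high0 1 (n - 4).+2 (e 2) r) //; try lia; last by apply: e_mem; lia.
  rewrite (@g1_br_high0 2 (n - 3) t) //; try lia; last by apply: e_mem; lia.
  by apply/rowP => i; rewrite !mxE; ring.
exists a, be => j jn; rewrite /b1 /wt /p1 /q1.
case: j jn => [|j] jn /=.
  by rewrite E1 mulr1 mulr0 addr0 [a *: _ + s]addrC addrK.
have [h|h] := ltnP j.+1 (n - 1).
  by rewrite mulr1 addrC subn1 /= addrC; have := Dc j; rewrite [be + _]addrC; apply; lia.
have -> : j.+2 = n by lia.
by rewrite Dn [be *+ 2 + _]addrC -[be *+ 2]mulr_natr subrr mem0v.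
Qed.

End G1.

Section G1Basis.
Variables (F : numFieldType) (n : nat).
Notation V := 'rV[F]_(n + 2).
Variables (br : V -> V -> V) (e : nat -> V).
Hypotheses (Lbr : leibniz_algebra br) (n5 : (5 < n)%N).
Hypothesis rel : g1_rel n br e.
Notation U := (flag n (b1 e)).
Notation p1 := (p1 n). Notation q1 := (q1 n).
Hypothesis free_b : free [seq b1 e j | j <- iota 0 n].
Hypothesis derived_N : forall u v, br u v \in U 0.
Variable z : V.
Hypothesis Hz : diag_wt br n (b1 e) p1 q1 z 1 n%:R.

Let e_mem i k : (k < i <= n)%N -> e i \in U k.
Proof. by case: i => // i iI; apply: (flag_mem (b1 e)); lia. Qed.

Let weight_e j : (1 <= j < n - 1)%N -> weight n p1 q1 j = (j - 1 + n)%N.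
Proof.
move=> jI; have j0 : (j == 0%N) = false by lia.
by have /andP[_ j1] := jI; rewrite /weight /p1 /q1 j0 j1; lia.
Qed.

Let weight_n : weight n p1 q1 (n - 1) = (3 * n - 4)%N.
Proof. by rewrite /weight /p1 /q1; rewrite !ifF; lia. Qed.

(** The condition on [m] describes exactly the complement of the weights 1, n, ..., 2n - 3, 3n -
    4. *)
Let no_weight m v : br v z = m%:R *: v -> v \in U 0 ->
  (m != 1)%N -> (m < n)%N || (2 * n - 3 < m)%N && (m != 3 * n - 4)%N -> v = 0.
Proof.
move=> Ev vU m1 mI; apply: (no_weight Lbr Hz free_b vU Ev) => j jn.
have [->|j0] := posnP j; first by rewrite /weight /p1 /q1 /=; lia.
have [jn1|jn1] := ltnP j (n - 1); first by rewrite weight_e; lia.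
have -> : (j = n - 1)%N by lia.
by rewrite weight_n; lia.
Qed.

(** Eigenvectors [x], [y] of weights 1 and n replace the generators e_1, e_2, and the other vectors
    are rebuilt from them by the same brackets. Weights add, leading terms agree with the old basis,
    and the vanishing relations hold for lack of a weight. *)
Lemma g1_adapted_basis : exists g : nat -> V,
  [/\ forall j, (j < n)%N -> g j.+1 - b1 e j \in U j.+1,
      forall j, (j < n)%N -> br (g j.+1) z = (weight n p1 q1 j)%:R *: g j.+1 &
      g1_rel n br g].
Proof.
have [anti H1 H2 H3 H4] := rel.
have [n0 n1] : (0 < n)%N /\ (1 < n)%N by lia.
have winj i j := @weight1_inj n i j n5.
have [x xU Ex] := eigvec_ex Lbr Hz winj n0.
have [y yU Ey] := eigvec_ex Lbr Hz winj n1.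
have antiN : forall u v, u \in U 0 -> v \in U 0 -> br u v = - br v u.
  by apply: (antisym_flag Lbr) => i j iI jI; apply: anti; lia.
pose c k := iter k (br x) y.
pose g a := if a == 1%N then x else if (a < n)%N then c (a - 2)%N else br y (c (n - 4)%N).
have g1 : g 1 = x by [].
have gc k : (k.+2 < n)%N -> g k.+2 = c k by move=> kn; rewrite /g /= kn subn2.
have gn : g n = br y (c (n - 4)%N) by rewrite /g ltnn ifF //; lia.
have gS i : (2 <= i <= n - 2)%N -> br (g 1) (g i) = g i.+1.
  by case: i => [|[|i]] // iI; rewrite !gc //; lia.
pose s := x - e 1; have {}xU : s \in U 1 := xU; have Es : x = e 1 + s by rewrite addrC subrK.
have cU k : (k.+2 < n)%N -> c k - e k.+2 \in U k.+2.
  elim: k => [|k IHk] kn; first exact: yU.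
  have := IHk (ltnW kn); rewrite -/(c k).
  set r := _ - _ => rU; have Er : c k = e k.+2 + r by rewrite addrC subrK.
  have -> : c k.+1 - e k.+3 = br (e 1) r + (br s (e k.+2) + br s r).
    rewrite /c iterS -/(c k) Er Es (brDr Lbr) !(brDl Lbr) H1; last lia.
    by apply/rowP => i; rewrite !mxE; ring.
  rewrite rpredD //; first exact: (g1_br_e1 Lbr n5 rel).
  rewrite rpredD //.
    by apply: flagW (g1_br_high Lbr n5 rel _ _ xU (e_mem (_ : 1 < k.+2 <= n)%N)) => //; lia.
  by apply: flagW (g1_br_high Lbr n5 rel _ _ xU rU) => //; lia.
have gU j : (j < n)%N -> g j.+1 - b1 e j \in U j.+1.
  move=> jn; case: j jn => [|j] jn //.
  have [h|h] := ltnP j.+2 n; first by rewrite gc //; apply: cU.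
  have Ej : j.+2 = n by lia.
  have -> : b1 e j.+1 = e n by rewrite /b1 Ej.
  have n4 : (n - 4).+2 = (n - 2)%N by lia.
  pose r := c (n - 4)%N - e (n - 2)%N.
  have rU : r \in U (n - 2)%N by rewrite -n4 /r -n4; apply: cU; lia.
  rewrite Ej gn.
  have Er : c (n - 4)%N = e (n - 2)%N + r by rewrite addrC subrK.
  have en : br (e 2) (e (n - 2)%N) = e n by rewrite H4 ?expr2 ?mulrN1 ?opprK ?scale1r //; lia.
  pose t := y - e 2; have tU : t \in U 2 := yU; have Et : y = e 2 + t by rewrite addrC subrK.
  clearbody t; rewrite Er Et (brDr Lbr) !(brDl Lbr) en.
  rewrite (@g1_br_high0 _ _ _ _ Lbr n5 rel 1 (n - 2) (e 2) r) //; try lia; last by apply: e_mem; lia.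
  rewrite (@g1_br_high0 _ _ _ _ Lbr n5 rel 2 (n - 3) t (e (n - 2)%N)) //; try lia; last by apply: e_mem; lia.
  rewrite (@g1_br_high0 _ _ _ _ Lbr n5 rel 2 (n - 2) t r) //; try lia.
  by rewrite !addr0 subrr mem0v.
have cE k : (k.+2 < n)%N -> br (c k) z = (k + n)%:R *: c k.
  elim: k => [|k IHk] kn; first by rewrite Ey weight_e ?add0n //; lia.
  by have := weight_br Lbr Ex (IHk (ltnW kn)); rewrite {1}/weight /p1 /q1 /= muln0 addn0 add1n addSn.
have gE j : (j < n)%N -> br (g j.+1) z = (weight n p1 q1 j)%:R *: g j.+1.
  case: j => [|j] jn //.
  have [h|h] := ltnP j.+2 n; first by rewrite gc // cE // weight_e ?subn1 //; lia.
  have [-> ->] : j.+2 = n /\ j.+1 = (n - 1)%N by lia.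
  have h4 : ((n - 4).+2 < n)%N by lia.
  rewrite gn weight_n (weight_br Lbr Ey (cE _ h4)) weight_e; last lia.
  by congr (_%:R *: _); lia.
have gN a : (1 <= a <= n)%N -> g a \in U 0.
  by case: a => // a aI; apply: (eigvec_memN _ (gU a _)); lia.
have gEc i : (2 <= i < n)%N -> br (g i) z = (i - 2 + n)%:R *: g i.
  by case: i => [|[|i]] // iI; rewrite gE ?weight_e //; try lia; congr (_%:R *: _); lia.
have gEn : br (g n) z = (3 * n - 4)%:R *: g n.
  have jn : (n - 1 < n)%N by lia.
  by have := gE _ jn; rewrite weight_n (_ : (n - 1).+1 = n) //; lia.
have gE1 : br (g 1) z = 1%:R *: g 1 by rewrite gE // /weight /p1 /q1 /= muln0 addn0.
(* For [i, j < n] the bracket has weight 2n - 4 + i + j, which exceeds 2n - 3 and equals 3n - 4 only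
   if [i + j = n]. *)
have g0 i j : (2 <= i <= n)%N -> (2 <= j <= n)%N -> (i + j != n)%N -> br (g i) (g j) = 0.
  move=> iI jI ij.
  have [-> | i_n] := eqVneq i n.
    have [-> | j_n] := eqVneq j n; first by apply: antisym_alt; apply: antiN; apply: gN; lia.
    have jI' : (2 <= j < n)%N by lia.
    by apply: (no_weight (weight_br Lbr gEn (gEc _ jI'))) => //; lia.
  have iI' : (2 <= i < n)%N by lia.
  have [-> | j_n] := eqVneq j n.
    by apply: (no_weight (weight_br Lbr (gEc _ iI') gEn)) => //; lia.
  have jI' : (2 <= j < n)%N by lia.
  by apply: (no_weight (weight_br Lbr (gEc _ iI') (gEc _ jI'))) => //; lia.
exists g; split=> //; split=> //.
- by move=> a k aI kI; apply: antiN; apply: gN.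
- move=> i iI; have [-> | i_n] := eqVneq i n.
    by apply: (no_weight (weight_br Lbr gE1 gEn)) => //; lia.
  have iI' : (2 <= i < n)%N by lia.
  by apply: (no_weight (weight_br Lbr gE1 (gEc _ iI'))) => //; lia.
(* The case [i = 2] defines [g n]. For the step, right multiplication by [g 1] is applied to
   [g_i,g_(n-i-1)] = 0: the two resulting terms cancel, which flips the sign. *)
- move=> i; elim: i => // i IHi iI.
  have [i1|i1] := leqP i 1.
    have -> : i = 1%N by lia.
    rewrite expr2 mulrN1 opprK scale1r gn; have -> : (n - 2 = (n - 4).+2)%N by lia.
    by rewrite !gc //; lia.
  have {}IHi : br (g i) (g (n - i)%N) = (-1) ^+ i *: g n by apply: IHi; lia.
  have := br_derivation Lbr (g i) (g (n - i.+1)%N) (g 1).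
  rewrite (g0 i (n - i.+1)%N); try lia.
  have h1 : br (g (n - i.+1)%N) (g 1) = - g (n - i)%N.
    by rewrite antiN ?gN // ?gS; try lia; congr (- g _); lia.
  have h2 : br (g i) (g 1) = - g i.+1 by rewrite antiN ?gN // ?gS //; lia.
  rewrite h1 h2 (br0l Lbr) (brNr Lbr) (brNl Lbr) IHi => /esym/eqP.
  by rewrite -opprD oppr_eq0 addrC addr_eq0 exprS mulN1r scaleNr => /eqP.
Qed.

End G1Basis.

Lemma R1_unique (F : numFieldType) (n : nat)
    (br : 'rV[F]_(n + 2) -> 'rV[F]_(n + 2) -> 'rV[F]_(n + 2)) :
  (5 < n)%N -> odd n -> leibniz_algebra br -> solvable_alg br ->
  (exists N, is_nilradical br N /\ sub_iso (g1_br F n) br N) ->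
  alg_iso br (R1_br F n).
Proof.
move=> n5 on Lbr solv [N [nilN [M [fM MN dN brM]]]].
pose e k := ee F n k *m M.
have [||free_b NE] := sub_iso_basis fM MN dN (s := succn).
- by move=> j jn; lia.
- by move=> i j _ _ [].
rewrite -/(b1 e) in free_b NE.
have rel : g1_rel n br e.
  apply: g1_rel_table => // a b aI bI.
  by rewrite /e -brM /g1_br sc_bracket_ee // g1c_mul.
rewrite {N MN dN}NE in nilN.
have idN u v : u \in flag n (b1 e) 0 -> br u v \in flag n (b1 e) 0.
  by case: nilN => /(is_idealP Lbr) H _ _ uN; case: (H u v uN).
have wt_ex := g1_diag_wt_ex Lbr n5 rel idN free_b.
have wt_N := g1_diag_wt_N Lbr n5 rel.
have derN := derived_sub_nilradical Lbr nilN wt_ex wt_N solv.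
have nil_mem := diag_wt_nil_mem Lbr nilN wt_ex wt_N solv.
have wpos j := @weight1_gt0 n j n5.
have winj i j := @weight1_inj n i j n5.
have [z [x [y [Hz Hx Hy xz yz]]]] := torus_ex Lbr wt_N derN wt_ex nil_mem wpos.
have [g [gU gE relg]] := g1_adapted_basis Lbr n5 rel free_b derN Hz.
have [anti H1 H2 H3 H4] := relg.
have gN a : (1 <= a <= n)%N -> g a \in flag n (b1 e) 0.
  by case: a => // a aI; apply: (eigvec_memN _ (gU a _)); lia.
have antiN : forall u v, u \in flag n (b1 e) 0 -> v \in flag n (b1 e) 0 -> br u v = - br v u.
  by case: (rel) => antie _ _ _ _; apply: (antisym_flag Lbr) => i j iI jI; apply: antie; lia.
have g_neq0 a : (1 <= a <= n)%N -> g a != 0.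
  by case: a => // a aI; apply: (eigvec_neq0 free_b _ (gU a _)); lia.
apply: (alg_iso_torus Lbr free_b derN wt_ex nil_mem wpos winj Hz Hx Hy xz yz (s := succn) _ _ gU gE) => //.
- by case=> // a aI; exists a; lia.
- move=> j jn; rewrite /wx1 /p1 eqSS; case: eqP => // /eqP j0.
  by case: ifP.
- move=> j jn; rewrite /wy1 /q1 eqSS; case: eqP => // /eqP j0.
  by case: ifP.
- move=> Q HQ a c aI cI; rewrite (table_g1_rel n5 on relg) // g1c_mul.
  by apply: g1_table_ext => // k kI; rewrite HQ.
move=> t al be tz Ht.
have left v a : (1 <= a <= n)%N -> br v (g a) != 0 -> br t (g a) = - br (g a) t.
  case: a => // a aI va.
  by apply: (torus_left Lbr derN Hz winj free_b _ (gU a _) (gE a _) tz Ht va); lia.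
have g1t : br t (g 1) = - br (g 1) t.
  apply: (left (g 2)); first by lia.
  by rewrite anti ?H1 ?oppr_eq0 ?g_neq0 //; lia.
have git a : (2 <= a <= n - 2)%N -> br t (g a) = - br (g a) t.
  by move=> aI; apply: (left (g 1)); rewrite ?H1 ?g_neq0 //; lia.
move=> a aI; have [->//|a1] := eqVneq a 1%N.
(* The remaining [g n] and [g (n - 1)] are central in N, so they are written as brackets. *)
have [an2|an2] := leqP a (n - 2); first by apply: git; lia.
have [-> | an] := eqVneq a n.
  have -> : g n = br (g 2) (g (n - 2)%N) by rewrite H4 ?expr2 ?mulrN1 ?opprK ?scale1r //; lia.
  by apply: (antisym_br Lbr derN antiN); [apply: gN | apply: gN | apply: git | apply: git]; lia.
have -> : a = (n - 2).+1 by lia.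
rewrite -H1; last lia.
by apply: (antisym_br Lbr derN antiN) => //; [apply: gN | apply: gN | apply: git]; lia.
Qed.

(** * Nilradical of type g^2 *)

(* Derivations of g^2 are triangular in the order e_1, e_n, e_2, ..., e_(n-1);
   position j (from 0) holds e_(s2 j). *)
Definition s2 n j := (if j == 0 then 1 else if j == 1 then n else j)%N.
Definition p2 j := (if j == 0 then 1 else if j == 1 then 2 else j - 2)%N.
Definition q2 j := (if j < 2 then 0 else 1)%N.

Lemma weight2E n j : (2 <= j)%N -> weight n p2 q2 j = (j - 2 + n)%N.
Proof. by case: j => [|[|j]] // _; rewrite /weight /p2 /q2 /= muln1. Qed.

Lemma weight2_gt0 n j : (5 < n)%N -> (j < n)%N -> (0 < weight n p2 q2 j)%N.
Proof. by case: j => [|[|j]] n5 jn //; rewrite weight2E //; lia. Qed.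

(** In order, the weights are 1, 2, then n, ..., 2n - 3. *)
Lemma weight2_inj n i j : (5 < n)%N -> (i < n)%N -> (j < n)%N ->
  weight n p2 q2 i = weight n p2 q2 j -> i = j.
Proof.
have w0 : weight n p2 q2 0 = 1%N by rewrite /weight /p2 /q2 /= muln0.
have w1 : weight n p2 q2 1 = 2%N by rewrite /weight /p2 /q2 /= muln0.
by case: i => [|[|i]]; case: j => [|[|j]] n5 iI jI; rewrite ?w0 ?w1 ?weight2E //; lia.
Qed.

Section G2.
Variables (F : numFieldType) (n : nat).
Notation V := 'rV[F]_(n + 2).
Variables (br : V -> V -> V) (e : nat -> V).
Hypotheses (Lbr : leibniz_algebra br) (n5 : (5 < n)%N).
Hypothesis rel : g2_rel n br e.

Definition b2 j := e (s2 n j).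
Notation U := (flag n b2).

Let b2E j : (2 <= j)%N -> b2 j = e j.
Proof. by case: j => [|[|j]]. Qed.

Lemma g2_mem i k : (2 <= i < n)%N -> (k <= i)%N -> e i \in U k.
Proof. by move=> iI ki; rewrite -b2E; [apply: (flag_mem b2) |]; lia. Qed.

Lemma g2_mem1 : e 1 \in U 0.
Proof. by apply: (flag_mem b2 (j := 0)); lia. Qed.

Lemma g2_memn k : (k <= 1)%N -> e n \in U k.
Proof. by move=> k1; apply: (flag_mem b2 (j := 1)); lia. Qed.

Lemma g2_br_e1 k v : (2 <= k)%N -> v \in U k -> br (e 1) v \in U k.+1.
Proof.
case: rel => _ H1 H2 _ _ k1; move: v.
apply: flag_ind; first exact: lin_closed_brr (lin_closed_mem _).
move=> j jI; rewrite b2E; last lia; have [h|h] := leqP j (n - 2).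
  by rewrite H1; [apply: g2_mem | ]; lia.
by rewrite H2 ?mem0v //; lia.
Qed.

Lemma g2_br_en k v : (2 <= k)%N -> v \in U k -> br v (e n) \in U k.+2.
Proof.
case: rel => _ _ _ _ [H4 H5] k1; move: v.
apply: flag_ind; first exact: lin_closed_brl (lin_closed_mem _).
move=> j jI; rewrite b2E; last lia; have [h|h] := leqP j (n - 3).
  by rewrite H4; [apply: g2_mem | ]; lia.
by rewrite H5 ?mem0v //; lia.
Qed.

Lemma g2_antisym u v : u \in U 0 -> v \in U 0 -> br u v = - br v u.
Proof.
case: rel => anti _ _ _ _; move: u v; apply: (antisym_flag Lbr) => i j iI jI.
by apply: anti; rewrite /s2; case: ifP => ?; rewrite ?ltnS; try lia; case: ifP; lia.
Qed.

Lemma g2_br_en' k v : (2 <= k)%N -> v \in U k -> br (e n) v \in U k.+2.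
Proof.
move=> k2 vU; rewrite g2_antisym ?rpredN ?g2_br_en ?g2_memn //.
by apply: flagW vU.
Qed.

Lemma g2_br_high k l u v : (2 <= k)%N -> (2 <= l)%N -> u \in U k -> v \in U l -> br u v = 0.
Proof.
case: rel => _ _ _ H3 _ k1 l1 uU vU; apply/eqP; rewrite -memv0.
move: u v uU vU; apply: (br_flag Lbr) => i j iI jI.
by rewrite !b2E ?H3 ?mem0v //; lia.
Qed.

Lemma g2_diag_wt_N u : u \in U 0 -> diag_wt br n b2 p2 q2 u 0 0.
Proof.
move=> uU; apply/diag_wt_nilP => j jn; move: u uU.
apply: flag_ind; first exact: lin_closed_brr (lin_closed_mem _).
case: (rel) => anti _ H2 _ _.
have e1n : br (e 1) (e n) = 0 by apply: H2; lia.
have en1 : br (e n) (e 1) = 0 by rewrite anti ?e1n ?oppr0 //; lia.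
have alt v : v \in U 0 -> br v v = 0 by move=> vU; apply/antisym_alt/g2_antisym.
case: j jn => [|[|j]] jn; case=> [|[|k]] kn; rewrite ?(b2E (isT : 1 < _.+2)%N) /b2 /s2 /=.
- by rewrite alt ?mem0v ?g2_mem1.
- by rewrite e1n mem0v.
- by apply: (flagW _ (g2_br_e1 _ (g2_mem _ (leqnn k.+2)))) => //; lia.
- by rewrite en1 mem0v.
- by rewrite alt ?mem0v ?g2_memn.
- by apply: (flagW _ (g2_br_en' _ (g2_mem _ (leqnn k.+2)))) => //; lia.
- by rewrite anti ?rpredN; [apply: (g2_br_e1 _ (g2_mem _ (leqnn j.+2))) | |] => //; lia.
- by apply: (flagW _ (g2_br_en _ (g2_mem _ (leqnn j.+2)))) => //; lia.
- by rewrite (g2_br_high _ _ (g2_mem _ (leqnn j.+2)) (g2_mem _ (leqnn k.+2))) ?mem0v //; lia.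
Qed.

Hypothesis idN : forall u v, u \in U 0 -> br u v \in U 0.
Hypothesis free_b : free [seq b2 j | j <- iota 0 n].

(** R_u is a derivation of N. The coefficients [dd], [ee], [rr] would break triangularity, and the
    diagonal entry [h] at e_n must be twice the one at e_1; each constraint comes from applying R_u
    to a relation of g^2. *)
Lemma g2_diag_wt_ex u : exists al be, diag_wt br n b2 p2 q2 u al be.
Proof.
case: (rel) => anti H1 H2 H3 [H4 H5].
have D v w : br (br v w) u = br v (br w u) + br (br v u) w by apply: br_derivation.
have n0 : (0 < n)%N by lia.
have n1 : (1 < n)%N by lia.
have n2 : (2 < n)%N by lia.
have n3 : (3 < n)%N by lia.
have n4 : (4 < n)%N by lia.
have n5' : (5 < n)%N by lia.
have e2I : e 2 \in U 2 by apply: g2_mem; lia.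
have e3I : e 3 \in U 3 by apply: g2_mem; lia.
have e11 : br (e 1) (e 1) = 0 by apply/antisym_alt/g2_antisym; apply: g2_mem1.
have enn : br (e n) (e n) = 0 by apply/antisym_alt/g2_antisym; apply: g2_memn.
have e1n : br (e 1) (e n) = 0 by apply: H2; lia.
have e12 : br (e 1) (e 2) = e 3 by apply: H1; lia.
have e13 : br (e 1) (e 3) = e 4 by apply: H1; lia.
have e2n : br (e 2) (e n) = e 4 by apply: H4; lia.
have e3n : br (e 3) (e n) = e 5 by apply: H4; lia.
have e21 : br (e 2) (e 1) = - e 3 by rewrite anti ?e12 //; lia.
have en2 : br (e n) (e 2) = - e 4 by rewrite anti ?e2n //; lia.
have en3 : br (e n) (e 3) = - e 5 by rewrite anti ?e3n //; lia.
have e23 : br (e 2) (e 3) = 0 by apply: H3; lia.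
have e1S k : (k.+3 < n)%N -> br (e 1) (e k.+2) = e k.+3 by move=> kn; apply: H1; lia.
have e1U : br (e 1) u \in U 0 by apply/idN/g2_mem1.
have enU : br (e n) u \in U 0 by apply/idN/g2_memn.
have e2U : br (e 2) u \in U 0 by apply/idN/flagW; first exact: (leq0n 2).
have [a Ha'] := flag_dec n0 e1U; have [c Ha] := flag_dec n1 Ha'.
have [dd Hd] := flag_dec n0 e2U; have [ee Hd'] := flag_dec n1 Hd.
have [be Hb] := flag_dec n2 Hd'.
have [rr Hr'] := flag_dec n0 enU; have [h Hr''] := flag_dec n1 Hr'.
have [ss Hr] := flag_dec n2 Hr''.
pose s := br (e 1) u - a *: e 1 - c *: e n; have {}Ha : s \in U 2 := Ha.
pose t := br (e 2) u - dd *: e 1 - ee *: e n - be *: e 2; have {}Hb : t \in U 3 := Hb.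
pose w := br (e n) u - rr *: e 1 - h *: e n - ss *: e 2; have {}Hr : w \in U 3 := Hr.
clear Ha' Hd Hd' Hr' Hr''.
have E1 : br (e 1) u = a *: e 1 + c *: e n + s.
  by rewrite /s; apply/rowP => i; rewrite !mxE; ring.
have E2 : br (e 2) u = dd *: e 1 + ee *: e n + be *: e 2 + t.
  by rewrite /t; apply/rowP => i; rewrite !mxE; ring.
have En : br (e n) u = rr *: e 1 + h *: e n + ss *: e 2 + w.
  by rewrite /w; apply/rowP => i; rewrite !mxE; ring.
clearbody s t w.
have Hs k : (2 <= k < n)%N -> br s (e k) = 0.
  move=> kI; have /andP[k2 _] := kI.
  exact: g2_br_high (leqnn 2) (leqnn 2) Ha (g2_mem kI k2).
have expand := ((brDr Lbr), (brDl Lbr), (brZr Lbr), (brZl Lbr)).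
(* Applying R_u to [e_2,e_3] = 0 leaves dd e_4 = ee e_5. *)
have [dd0 ee0] : dd = 0 /\ ee = 0.
  have D3 : br (e 3) u = (be + a) *: e 3 + (br (e 1) t - c *: e 4).
    rewrite -{1}e12 D E1 E2 !expand e11 e1n e12 en2 Hs //.
    by apply/rowP => i; rewrite !mxE; ring.
  have h1 : br (e 1) t \in U 4 by apply: g2_br_e1.
  have h0 : br (e 2) (br (e 3) u) = 0.
    apply: (g2_br_high (l := 3) _ _ e2I) => //; rewrite D3.
    by rewrite rpredD ?rpredZ // rpredB ?rpredZ ?g2_mem //; apply: flagW h1.
  have := D (e 2) (e 3); rewrite e23 (br0l Lbr) h0 add0r E2 !expand e13 en3 e23.
  rewrite (g2_br_high _ _ Hb e3I) // scaler0 !addr0 => /esym/eqP; rewrite scalerN subr_eq0 => /eqP E.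
  have d0 : dd = 0.
    by apply: (flag_free free_b n4); rewrite b2E // E rpredZ // g2_mem.
  split=> //; apply: (flag_free free_b n5'); rewrite b2E // -E d0 scale0r; exact: mem0v.
rewrite {}dd0 {}ee0 !scale0r !add0r in E2.
(* Applying R_u to [e_1,e_n] = 0 gives [ss] as the coefficient of e_3. *)
have ss0 : ss = 0.
  apply: (flag_free free_b n3); rewrite b2E //.
  have := D (e 1) (e n); rewrite e1n (br0l Lbr) E1 En !expand e11 e1n enn e12 !scaler0 !add0r => /esym/eqP.
  rewrite -addrA addr_eq0 => /eqP ->; rewrite rpredN rpredD //; first exact: g2_br_e1.
  exact: g2_br_en.
rewrite {}ss0 !scale0r addr0 in En.
have D3 : br (e 3) u = (be + a) *: e 3 + (br (e 1) t - c *: e 4).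
  rewrite -{1}e12 D E1 E2 !expand e12 en2 Hs //.
  by apply/rowP => i; rewrite !mxE; ring.
set r := _ - c *: _ in D3.
have rU : r \in U 4 by rewrite rpredB ?rpredZ ?g2_mem // g2_br_e1.
clearbody r.
(* R_u is applied to both sides of [e_2,e_n] = [e_1,e_3]; the coefficients of e_3 and e_4 then yield
   rr = 0 and h = 2a. *)
have e4eq : - rr *: e 3 + (h - a - a) *: e 4 \in U 5.
  have := D (e 2) (e n); rewrite e2n -{1}e13 D E1 E2 D3 En !expand e13 e21 e2n en3 Hs //.
  rewrite (g2_br_high _ _ e2I Hr) // => E.
  have -> : - rr *: e 3 + (h - a - a) *: e 4 = br (e 1) r - c *: e 5 - br t (e n).
    apply/rowP => i; move/rowP/(_ i): E; rewrite !mxE => E.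
    apply/eqP; rewrite -subr_eq0; apply/eqP.
    by move/eqP: E; rewrite -subr_eq0 => /eqP E; rewrite -[RHS]oppr0 -[in RHS]E; ring.
  by rewrite !rpredB ?rpredZ ?g2_br_e1 ?g2_br_en ?g2_mem.
have rr0 : rr = 0.
  apply/eqP; rewrite -oppr_eq0; apply/eqP/(flag_free free_b n3); rewrite b2E //.
  rewrite -[_ *: e 3](addrK ((h - a - a) *: e 4)) rpredB ?rpredZ ?g2_mem //.
  exact: flagW e4eq.
have h0 : h = a * 2.
  rewrite rr0 oppr0 scale0r add0r in e4eq.
  have : h - a - a = 0 by apply: (flag_free free_b n4); rewrite b2E.
  by move/eqP; rewrite -addrA -opprD subr_eq0 => /eqP ->; rewrite mulr_natr mulr2n.
rewrite {}rr0 !scale0r add0r {}h0 in En.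
have Dc k : (k.+2 < n)%N -> br (e k.+2) u - (be + a * k%:R) *: e k.+2 \in U k.+3.
  elim: k => [|k IHk] kn.
    by rewrite E2 mulr0 addr0 [_ + t]addrC addrK.
  have {}IHk := IHk (ltnW kn).
  have ek := e1S _ kn.
  pose v := br (e k.+2) u - (be + a * k%:R) *: e k.+2; have {}IHk : v \in U k.+3 := IHk.
  have Ek : br (e k.+2) u = (be + a * k%:R) *: e k.+2 + v by rewrite /v addrC subrK.
  clearbody v.
  have -> : br (e k.+3) u - (be + a * k.+1%:R) *: e k.+3 = br (e 1) v + c *: br (e n) (e k.+2).
    rewrite -{1}ek D E1 Ek !expand ek Hs; last exact: ltnW.
    by rewrite -natr1; apply/rowP => i; rewrite !mxE; ring.
  rewrite rpredD //; first exact: g2_br_e1.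
  by apply/rpredZ/g2_br_en' => //; apply: g2_mem => //; exact: ltnW.
exists a, be => j jn; case: j jn => [|[|j]] jn.
- rewrite /wt /p2 /q2 /= mulr1 mulr0 addr0 -[b2 0]/(e 1) E1 -[a *: _ + _ + s]addrA [a *: _ + _]addrC addrK.
  by rewrite rpredD ?rpredZ ?g2_memn //; apply: flagW Ha.
- rewrite /wt /p2 /q2 /= mulr0 addr0 -[b2 1]/(e n) En [_ + w]addrC addrK.
  exact: flagW Hr.
- rewrite b2E // /wt /p2 /q2 /= subn2 /= mulr1 [a * _ + be]addrC; exact: Dc.
Qed.

End G2.

Section G2Basis.
Variables (F : numFieldType) (n : nat).
Notation V := 'rV[F]_(n + 2).
Variables (br : V -> V -> V) (e : nat -> V).
Hypotheses (Lbr : leibniz_algebra br) (n5 : (5 < n)%N).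
Hypothesis rel : g2_rel n br e.
Notation U := (flag n (b2 e)).
Notation weight := (weight n p2 q2).
Hypothesis free_b : free [seq b2 e j | j <- iota 0 n].
Hypothesis derived_N : forall u v, br u v \in U 0.
Variable z : V.
Hypothesis Hz : diag_wt br n (b2 e) p2 q2 z 1 n%:R.

Let no_weight m v : br v z = m%:R *: v -> v \in U 0 ->
  (2 < m < n)%N || (2 * n - 3 < m)%N -> v = 0.
Proof.
move=> Ev vU mI; apply: (no_weight Lbr Hz free_b vU Ev) => j jn.
have [->|j0] := posnP j; first by rewrite /weight /p2 /q2 /=; lia.
have [->|j1] := eqVneq j 1%N; first by rewrite /weight /p2 /q2 /=; lia.
by rewrite weight2E; lia.
Qed.

(** Eigenvectors [x], [v], [y] of weights 1, 2 and n replace e_1, e_n and e_2; the others are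
    iterated brackets of [y] by [x]. The brackets with [g n] are not part of this construction and
    have to be recovered. *)
Lemma g2_adapted_basis : exists g : nat -> V,
  [/\ forall j, (j < n)%N -> g (s2 n j) - b2 e j \in U j.+1,
      forall j, (j < n)%N -> br (g (s2 n j)) z = (weight j)%:R *: g (s2 n j) &
      g2_rel n br g].
Proof.
have [anti H1 H2 H3 [H4 H5]] := rel.
have n0 : (0 < n)%N by lia.
have n1 : (1 < n)%N by lia.
have n2 : (2 < n)%N by lia.
have winj i j := @weight2_inj n i j n5.
have [x xU0 Ex] := eigvec_ex Lbr Hz winj n0.
have [v vU Ev] := eigvec_ex Lbr Hz winj n1.
have [y yU Ey] := eigvec_ex Lbr Hz winj n2.
have antiN := g2_antisym Lbr n5 rel.
pose c k := iter k (br x) y.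
pose g a := if a == 1%N then x else if a == n then v else c (a - 2)%N.
have g1 : g 1 = x by [].
have gn : g n = v by rewrite /g eqxx ifF //; lia.
have gc k : (k.+2 < n)%N -> g k.+2 = c k.
  by move=> kn; rewrite /g /= ifF ?subn2 //; lia.
have gS i : (2 <= i <= n - 2)%N -> br (g 1) (g i) = g i.+1.
  by case: i => [|[|i]] // iI; rewrite !gc //; lia.
have [co sU] := flag_dec n1 xU0.
pose s := x - e 1 - co *: e n; have {}sU : s \in U 2 := sU.
have Es : x = e 1 + co *: e n + s by rewrite /s; apply/rowP => i; rewrite !mxE; ring.
clearbody s.
have cU k : (k.+2 < n)%N -> c k - e k.+2 \in U k.+3.
  elim: k => [|k IHk] kn; first exact: yU.
  pose r := c k - e k.+2; have rU : r \in U k.+3 by apply: IHk; apply: ltnW.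
  have Er : c k = e k.+2 + r by rewrite addrC subrK.
  have kI : (2 <= k.+2 < n)%N by rewrite (ltnW kn).
  have cU2 : c k \in U k.+2.
    by rewrite Er; apply: rpredD; [apply: g2_mem | apply: flagW rU].
  have -> : c k.+1 - e k.+3 = br (e 1) r + (co *: br (e n) (c k) + br s (c k)).
    rewrite /c iterS -/(c k) {1}Es !(brDl Lbr) (brZl Lbr) {1}Er (brDr Lbr) H1; last lia.
    by apply/rowP => i; rewrite !mxE; ring.
  rewrite (g2_br_high Lbr n5 rel (leqnn 2) _ sU cU2) // addr0 rpredD //.
    exact: (g2_br_e1 Lbr n5 rel).
  by apply/rpredZ/(g2_br_en' Lbr n5 rel).
have gU j : (j < n)%N -> g (s2 n j) - b2 e j \in U j.+1.
  case: j => [|[|j]] jn; rewrite /s2 /=; first exact: xU0.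
    by rewrite gn.
  by rewrite gc //; apply: cU.
have cE k : (k.+2 < n)%N -> br (c k) z = (k + n)%:R *: c k.
  elim: k => [|k IHk] kn; first by rewrite Ey weight2E ?add0n.
  by have := weight_br Lbr Ex (IHk (ltnW kn)); rewrite {1}/weight /p2 /q2 /= muln0 addn0 add1n addSn.
have gE j : (j < n)%N -> br (g (s2 n j)) z = (weight j)%:R *: g (s2 n j).
  case: j => [|[|j]] jn; rewrite /s2 /=; first exact: Ex.
    by rewrite gn.
  by rewrite gc // cE // weight2E ?subn2.
have gE1 : br (g 1) z = 1%:R *: g 1.
  by rewrite g1 Ex /weight /p2 /q2 /= muln0 addn0.
have gEn : br (g n) z = 2%:R *: g n.
  by rewrite gn Ev /weight /p2 /q2 /= muln0 addn0.
have gEc i : (2 <= i < n)%N -> br (g i) z = (i - 2 + n)%:R *: g i.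
  by case: i => [|[|i]] // iI; rewrite gc // cE // subn2.
have gN a : (1 <= a <= n)%N -> g a \in U 0.
  move=> aI; have [->|a1] := eqVneq a 1%N; first by apply: (eigvec_memN n0 (gU _ n0)).
  have [->|an] := eqVneq a n; first by rewrite -[g n]/(g (s2 n 1)); apply: (eigvec_memN n1 (gU _ n1)).
  case: a aI a1 an => [|[|a]] // aI _ an; have jn : (a.+2 < n)%N by lia.
  by have := eigvec_memN jn (gU _ jn).
have g1n : br (g 1) (g n) = 0.
  by apply: (no_weight (weight_br Lbr gE1 gEn)) => //; lia.
exists g; split=> //; split=> //.
- by move=> a k aI kI; apply: antiN; apply: gN.
- move=> i iI; have [-> // | i_n] := eqVneq i n.
  have iI' : (2 <= i < n)%N by lia.
  by apply: (no_weight (weight_br Lbr gE1 (gEc _ iI'))) => //; lia.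
- move=> i j iI jI.
  by apply: (no_weight (weight_br Lbr (gEc _ iI) (gEc _ jI))) => //; lia.
split; last first.
  move=> i iI; have iI' : (2 <= i < n)%N by lia.
  by apply: (no_weight (weight_br Lbr (gEc _ iI') gEn)) => //; lia.
elim=> // i IHi iI.
have [i1|i1] := leqP i 1.
  have -> : i = 1%N by lia.
  have n4 : (4 < n)%N by lia.
  (* [g_2,g_n] has the weight n + 2 of [g 4], hence lies on its eigenline; the leading term e_4 of
     [e_2,e_n] shows that the factor is 1. *)
  rewrite -[g 4]scale1r; apply: (eigvec_coef free_b n4 (gU 4 n4)).
    rewrite scale1r gn gc // -[c 0]/y.
    pose t := y - e 2; have tU : t \in U 3 := yU; have Et : y = e 2 + t by rewrite addrC subrK.
    pose w := v - e n; have wU : w \in U 2 := vU; have Ew : v = e n + w by rewrite addrC subrK.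
    have e2U : e 2 \in U 2 by apply: g2_mem; lia.
    clearbody t w.
    rewrite Et Ew !(brDl Lbr) !(brDr Lbr) H4; last lia.
    rewrite (g2_br_high Lbr n5 rel _ _ e2U wU) // (g2_br_high Lbr n5 rel _ _ tU wU) //.
    by rewrite !addr0 -[b2 e 4]/(e 4) addrAC subrr add0r; apply: (g2_br_en Lbr n5 rel).
  apply: (eigline Lbr Hz winj free_b n4 (gU _ n4) (gE _ n4)) => //.
  have I2 : (2 <= 2 < n)%N by lia.
  rewrite (weight_br Lbr (gEc _ I2) gEn) weight2E //.
  by congr (_%:R *: _); lia.
(* Since [g_1,g_n] = 0, right multiplication by [g n] commutes with left multiplication by [g 1],
   which carries the relation from [i] to [i + 1]. *)
rewrite -gS; last lia.
rewrite (br_derivation Lbr) g1n (br0l Lbr) addr0 IHi ?gS //; lia.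
Qed.

End G2Basis.

Lemma R2_unique (F : numFieldType) (n : nat)
    (br : 'rV[F]_(n + 2) -> 'rV[F]_(n + 2) -> 'rV[F]_(n + 2)) :
  (5 < n)%N -> leibniz_algebra br -> solvable_alg br ->
  (exists N, is_nilradical br N /\ sub_iso (g2_br F n) br N) ->
  alg_iso br (R2_br F n).
Proof.
move=> n5 Lbr solv [N [nilN [M [fM MN dN brM]]]].
pose e k := ee F n k *m M.
have s_range j : (j < n)%N -> (1 <= s2 n j <= n)%N by case: j => [|[|j]] jn; rewrite /s2 /=; lia.
have s_inj i j : (i < n)%N -> (j < n)%N -> s2 n i = s2 n j -> i = j.
  by case: i => [|[|i]]; case: j => [|[|j]]; rewrite /s2 /=; lia.
have s_surj a : (1 <= a <= n)%N -> exists2 j, (j < n)%N & s2 n j = a.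
  move=> aI; have [->|a1] := eqVneq a 1%N; first by exists 0%N => //; lia.
  have [->|an] := eqVneq a n; first by exists 1%N => //; lia.
  by exists a; [lia | case: a aI a1 an => [|[|a]]].
have [free_b NE] := sub_iso_basis fM MN dN s_range s_inj.
rewrite -/(b2 e) in free_b NE.
have rel : g2_rel n br e.
  apply: g2_rel_table => // a b aI bI.
  by rewrite /e -brM /g2_br sc_bracket_ee // g2c_mul.
rewrite {N MN dN}NE in nilN.
have idN u v : u \in flag n (b2 e) 0 -> br u v \in flag n (b2 e) 0.
  by case: nilN => /(is_idealP Lbr) H _ _ uN; case: (H u v uN).
have wt_ex := g2_diag_wt_ex Lbr n5 rel idN free_b.
have wt_N := g2_diag_wt_N Lbr n5 rel.
have derN := derived_sub_nilradical Lbr nilN wt_ex wt_N solv.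
have nil_mem := diag_wt_nil_mem Lbr nilN wt_ex wt_N solv.
have wpos j := @weight2_gt0 n j n5.
have winj i j := @weight2_inj n i j n5.
have [z [x [y [Hz Hx Hy xz yz]]]] := torus_ex Lbr wt_N derN wt_ex nil_mem wpos.
have [g [gU gE relg]] := g2_adapted_basis Lbr n5 rel free_b derN Hz.
have [anti H1 H2 H3 [H4 H5]] := relg.
have gN a : (1 <= a <= n)%N -> g a \in flag n (b2 e) 0.
  by move=> /s_surj[j jn <-]; apply: (eigvec_memN jn (gU j jn)).
have antiN := g2_antisym Lbr n5 rel.
have g_neq0 a : (1 <= a <= n)%N -> g a != 0.
  by move=> /s_surj[j jn <-]; apply: (eigvec_neq0 free_b jn (gU j jn)).
apply: (alg_iso_torus Lbr free_b derN wt_ex nil_mem wpos winj Hz Hx Hy xz yz s_range s_surj gU gE).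
- case=> [|[|j]] jn; rewrite /wx2 /p2 /s2 //=; first by rewrite !ifF //; lia.
  by rewrite ifT //; lia.
- case=> [|[|j]] jn; rewrite /wy2 /q2 /s2 //=; first by rewrite !ifF //; lia.
  by rewrite ifT //; lia.
- move=> Q HQ a c aI cI; rewrite (table_g2_rel n5 relg) // g2c_mul.
  by apply: g2_table_ext => // k kI; rewrite HQ.
move=> t al be tz Ht.
have left v a : (1 <= a <= n)%N -> br v (g a) != 0 -> br t (g a) = - br (g a) t.
  move=> /s_surj[j jn <-] va.
  exact: (torus_left Lbr derN Hz winj free_b jn (gU j jn) (gE j jn) tz Ht va).
have g1t : br t (g 1) = - br (g 1) t.
  apply: (left (g 2)); first by lia.
  by rewrite anti ?H1 ?oppr_eq0 ?g_neq0 //; lia.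
have git a : (2 <= a <= n - 2)%N -> br t (g a) = - br (g a) t.
  by move=> aI; apply: (left (g 1)); rewrite ?H1 ?g_neq0 //; lia.
move=> a aI; have [->//|a1] := eqVneq a 1%N.
have [an2|an2] := leqP a (n - 2); first by apply: git; lia.
have [-> | an] := eqVneq a n.
  by apply: (left (g 2)); rewrite ?H4 ?g_neq0 //; lia.
(* [g (n - 1)] is central in N, so it is treated as the bracket [g_1,g_(n-2)]. *)
have -> : a = (n - 2).+1 by lia.
rewrite -H1; last lia.
by apply: (antisym_br Lbr derN antiN) => //; [apply: gN | apply: gN | apply: git]; lia.
Qed.

Theorem theorem3p7 (R : realType) (n : nat) (hn : (5 < n)%N) :
  (odd n ->
   forall br : 'rV[R[i]]_(n + 2) -> 'rV[R[i]]_(n + 2) -> 'rV[R[i]]_(n + 2),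
     leibniz_algebra br -> solvable_alg br ->
     (exists N, is_nilradical br N /\ sub_iso (g1_br R[i] n) br N) ->
     alg_iso br (R1_br R[i] n)) /\
  (forall br : 'rV[R[i]]_(n + 2) -> 'rV[R[i]]_(n + 2) -> 'rV[R[i]]_(n + 2),
     leibniz_algebra br -> solvable_alg br ->
     (exists N, is_nilradical br N /\ sub_iso (g2_br R[i] n) br N) ->
     alg_iso br (R2_br R[i] n)).
Proof.
split=> [on|] br Lbr solv nilrad; first exact: R1_unique.
exact: R2_unique.
Qed.
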